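(* The reciprocal gamma function can be expressed using the rational Taylor (Maclaurin) power series $$\frac{1}{\Gamma(x+1)}=\sum_{k=0}^{\infty}a_k x^k = 1+\gamma x+\frac{1}{12}\left(6\gamma^2-\pi^2\right)x^2+\cdots,$$ where $$a_k=\sum_{n=0}^{\infty}(-1)^n s(n,k)\frac{L_n(1)}{n!}.$$
   Context: $\Gamma$ is the gamma function and $\gamma$ is the Euler–Mascheroni constant. $L_n(1)$ is the value at $x=1$ of the Laguerre polynomial $L_n(x)=\sum_{j=0}^{n}\binom{n}{j}\frac{(-1)^j}{j!}x^j$. $s(n,k)$ are the signed Stirling numbers of the first kind, i.e. $\binom{x}{n}=\frac{1}{n!}\sum_{k=0}^{\infty}s(n,k)x^k$, with the convention $s(n,k)=0$ for $k>n$. *)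

(* Defs.v *)
From HB Require Import structures.
From mathcomp Require Import all_boot all_order all_algebra.
From mathcomp Require Import all_classical all_reals all_analysis.
From mathcomp Require Import complex.

Set Implicit Arguments.
Unset Strict Implicit.
Unset Printing Implicit Defensive.

Import Order.TTheory GRing.Theory Num.Theory.
Import numFieldNormedType.Exports.

Local Open Scope classical_set_scope.
Local Open Scope ring_scope.
Local Open Scope complex_scope.

Definition laguerre (n : nat) : {poly rat} :=
  \poly_(j < n.+1) ('C(n, j)%:R * ((-1) ^+ j / j`!%:R)).

(* n! * binom(x, n) = x (x - 1) ... (x - n + 1) as a polynomial in x, so that
   its k-th coefficient is s(n, k), which is 0 for k > n. *)
Definition falling_poly (n : nat) : {poly int} := \prod_(i < n) ('X - i%:R%:P).

Definition stirling1 (n k : nat) : int := (falling_poly n)`_k.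

Definition rgamma_term (k n : nat) : rat :=
  (-1) ^+ n * (stirling1 n k)%:~R * ((laguerre n).[1] / n`!%:R).

Definition rgamma_coef (R : realType) (k : nat) : R :=
  limn (series (fun n => ratr (rgamma_term k n) : R)).

Definition euler_mascheroni (R : realType) : R :=
  limn (fun n : nat => (\sum_(1 <= j < n.+1) j%:R^-1) - ln n%:R : R).

(* Euler's integral of t^(z - 1) e^(-t) over t > 0, meaningful for Re z > 0,
   split into real and imaginary parts by
   t^(z - 1) = t^(Re z - 1) (cos (Im z ln t) + i sin (Im z ln t)). *)
Definition Gamma_integral (R : realType) (z : R[i]) : R[i] :=
  (\int[lebesgue_measure]_(t in `]0, +oo[)
     (t `^ (complex.Re z - 1) * expR (- t) * cos (complex.Im z * ln t)))
  +i*
  (\int[lebesgue_measure]_(t in `]0, +oo[)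
     (t `^ (complex.Re z - 1) * expR (- t) * sin (complex.Im z * ln t))).

(* Analytic continuation of Euler's integral through
   Gamma z = Gamma (z + m) / (z (z + 1) ... (z + m - 1)), where m is the least
   natural number such that Re z + m > 0 (m = 0 when Re z > 0).
   At the poles 0, -1, -2, ... the denominator vanishes, so Gamma z = 0 and
   (Gamma z)^-1 = 0, the value of the entire function 1 / Gamma there. *)
Definition Gamma (R : realType) (z : R[i]) : R[i] :=
  let m := Num.truncn (1 - complex.Re z) in
  Gamma_integral (z + m%:R) / \prod_(j < m) (z + j%:R).

(* Main.v *)
Require Import Defs.
From mathcomp Require Import all_boot all_order all_algebra.
From mathcomp Require Import all_classical all_reals all_analysis.
From mathcomp Require Import measurable_realfun.
From mathcomp Require Import complex.
From mathcomp Require Import ring lra zify.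

(** The proof rests on the Gauss products
      [G_N(x) = C(x + N, N) (N + 1)^(-x)
              = (1 + x) (1 + x/2) ... (1 + x/N) exp(- x ln (N + 1))],
    which tend to [1 / Gamma(x + 1)], and compares their expansions in the
    Newton basis [C(x, n)] and in powers of [x].

    In the Newton basis the [n]-th coefficient of [G_N] is, up to the sign
    [(-1)^n], a finite binomial sum [meixner N n] that tends to [L_n(1)] when
    [N] grows. Re-expanding [C(x, n)] in powers of [x] brings in the Stirling
    numbers, so the [k]-th Taylor coefficient of [G_N] is the sum over [n] of
    [(-1)^n s(n, k) / n! * meixner N n] ([newton_to_power]). Formally the limit
    of these sums is [a_k]. What justifies it is a bound on [meixner N n] by a
    power of [1/n], uniform in [N] ([meixner_decay]): in [n] these numbers solve
    a damped second-order difference equation, and a quadratic energy decreases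
    at a rate that does not depend on the damping. As [|s(n, k)| / n!] is only
    slightly larger than [1/n], any such power is enough, and [a_k] converges
    and is the limit of the [k]-th Taylor coefficients ([rgamma_coef_cvg]).

    In powers of [x], regrouping [G_N] into Weierstrass factors
    [(1 + x/j) exp(- x/j) = 1 + O(x^2 / j^2)] bounds its coefficients, in every
    weighted l1-norm, uniformly in [N] ([majorized_gauss_coef]). By dominated
    convergence [sum a_k x^k] converges for every complex [x] to the limit of
    [G_N(x)] ([rgamma_series_cvg]).

    That limit is [1 / Gamma(x + 1)] by Gauss's argument: the beta integral of
    [t^(z-1) (1 - t/L)^N] over [[0, L]] is explicit ([mellin_beta_weight]), it tends to
    Euler's integral by dominated convergence, and a functional equation leaves
    the right half-plane ([gauss_rgamma_cvg]).

    The first coefficients of [G_N] are [1], [H_N - ln (N + 1)] and half of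
    [(H_N - ln (N + 1))^2 - sum_(j <= N) 1/j^2]; their limits give [a_0], [a_1]
    and, with [sum 1/j^2 = pi^2 / 6] ([basel]), [a_2]. *)

Import Order.TTheory GRing.Theory Num.Theory.
Import numFieldNormedType.Exports.
Import ComplexField.Normc.

Local Open Scope classical_set_scope.
Local Open Scope ring_scope.
Local Open Scope complex_scope.

(** * Binomial transforms *)

Section BinomialTransform.
Context {R : realFieldType}.
Implicit Types (w : nat -> R) (n : nat).

(** At the weights [1 / i!] this transform is [L_n(1)], and any [w] is
    interpolated at the naturals by the Newton series with coefficients
    [(-1)^n * bin_transform w n]. *)
Definition bin_transform w n : R :=
  \sum_(i < n.+1) (-1) ^+ i * 'C(n, i)%:R * w i.

Lemma bin_transformS w n : bin_transform w n.+1 = bin_transform w n - bin_transform (w \o succn) n.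
Proof.
rewrite /bin_transform big_ord_recl /= [X in _ = X - _]big_ord_recl /= !bin0.
rewrite -addrA; congr (_ + _).
rewrite (eq_bigr (fun i : 'I_n.+1 =>
    (-1) ^+ i.+1 * 'C(n, i.+1)%:R * w i.+1 - (-1) ^+ i * 'C(n, i)%:R * w i.+1)); last first.
  by move=> i _; rewrite /bump /= add1n binS natrD exprS; ring.
rewrite sumrB; congr (_ - _).
by rewrite big_ord_recr /= bin_small // mulr0 mul0r addr0.
Qed.

Lemma bin_transform_eq {w1 w2} n : w1 =1 w2 -> bin_transform w1 n = bin_transform w2 n.
Proof. by move=> e; apply: eq_bigr => i _; rewrite e. Qed.

Lemma bin_transform_lin a b w1 w2 n :
  bin_transform (fun i => a * w1 i + b * w2 i) n = a * bin_transform w1 n + b * bin_transform w2 n.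
Proof. by rewrite !mulr_sumr -big_split; apply: eq_bigr => i _ /=; ring. Qed.

(** Together with [bin_transform_lin] and [bin_transformS] this turns a first-order recurrence
    of the weights into a recurrence of their transform. *)
Lemma bin_transform_muln w n :
  bin_transform (fun i => i%:R * w i) n.+1 = n.+1%:R * (bin_transform w n.+1 - bin_transform w n).
Proof.
rewrite [in RHS]bin_transformS addrAC subrr add0r mulrN mulr_sumr -sumrN.
rewrite /bin_transform big_ord_recl /= mul0r mulr0 add0r; apply: eq_bigr => i _.
rewrite /bump /= add1n exprS.
have /(congr1 (fun m => m%:R : R)) := mul_bin_diag n.+1 i.
rewrite !natrM => e.
transitivity (- ((-1) ^+ i * w i.+1 * (i.+1%:R * 'C(n.+1, i.+1)%:R))); first by ring.
by rewrite -e /=; ring.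
Qed.

End BinomialTransform.

(** * Decay of solutions of a damped difference equation *)

Section Energy.
Context {R : realFieldType}.

(** A Lyapunov function for [y'' + (1/n + (1 - q)) y' + y / n = 0], where [z]
    stands for [n y']. The first two terms alone only bound [y]; the cross term
    spreads the dissipation over [y] and [z], which yields a power decay. *)
Definition energy (n y z : R) := y ^+ 2 + z ^+ 2 / n - y * z / (2 * n).

Lemma energy_ge n y z : 1 <= n -> y ^+ 2 <= 2 * energy n y z.
Proof.
move=> n1; rewrite -subr_ge0.
have n0 : n != 0 by rewrite gt_eqF // (lt_le_trans _ n1).
rewrite (_ : _ - _ = (n * y ^+ 2 + 2 * z ^+ 2 - y * z) / n); last first.
  by rewrite /energy; field; rewrite n0.
have h1 : 0 <= (n - 1) * y ^+ 2 by rewrite mulr_ge0 ?sqr_ge0 // subr_ge0.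
have := sqr_ge0 (y - z); have := sqr_ge0 y; have := sqr_ge0 z.
by rewrite divr_ge0 //; [nra|lra].
Qed.

(** The damping factor [q] enters quadratically and convexly, so it suffices to
    treat [q = 0] and [q = 1]; the decay rate is then independent of [q]. *)
Lemma energy_step n q y z : 8 <= n -> 0 <= q <= 1 ->
  energy (n + 1) (y + (q * z - y) / (n + 1)) (q * z - y) <=
  (1 - (4 * (n + 1))^-1) * energy n y z.
Proof.
move=> n8 /andP[q0 q1].
have n0 : n != 0 by rewrite gt_eqF // (lt_le_trans _ n8).
have m0 : n + 1 != 0 by rewrite gt_eqF //; lra.
rewrite -subr_ge0.
(* [d1] and [d0] are the defects at [q = 1] and [q = 0], and [d2] is the
   convexity gain, all scaled by [4 n (n + 1)^2] *)
pose d1 := y ^+ 2 * (n ^+ 2 - n) + z ^+ 2 * (n + 3) + y * z * (5 / 2 * n - 3 / 2).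
pose d0 := y ^+ 2 * (n ^+ 2 - n) + z ^+ 2 * ((4 * n + 3) * (n + 1))
  - y * z * ((4 * n + 3) * (n + 1) / 2).
pose d2 := z ^+ 2 * (4 * n * (n + 1) + 2 * n).
rewrite (_ : _ - _ = (q * d1 + (1 - q) * d0 + q * (1 - q) * d2) / (4 * n * (n + 1) ^+ 2)); last first.
  by rewrite /energy /d1 /d0 /d2; field; rewrite n0 m0.
have d1_ge0 : 0 <= d1.
  rewrite /d1; have h1 : 0 <= (n - 8) * (n * y ^+ 2) by apply: mulr_ge0; [lra|apply: mulr_ge0; [lra|exact: sqr_ge0]].
  have h2 : 0 <= (5 / 4 * n - 3 / 4) * (y + z) ^+ 2 by apply: mulr_ge0; [nra|exact: sqr_ge0].
  have h3 : 0 <= (n - 8) * y ^+ 2 by apply: mulr_ge0; [nra|exact: sqr_ge0].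
  have h4 : 0 <= (n - 8) * z ^+ 2 by apply: mulr_ge0; [nra|exact: sqr_ge0].
  have h5 : 0 <= (n - 8) * (2 * y + z) ^+ 2 by apply: mulr_ge0; [nra|exact: sqr_ge0].
  have := sqr_ge0 y; have := sqr_ge0 z; have := sqr_ge0 (y + z); have := sqr_ge0 (2 * y + z).
  nra.
have d0_ge0 : 0 <= d0.
  rewrite /d0; have h1 : 0 <= ((4 * n + 3) * (n + 1)) * (z - y / 4) ^+ 2.
    by apply: mulr_ge0; [nra|exact: sqr_ge0].
  have h2 : 0 <= (n - 8) * (n * y ^+ 2) by apply: mulr_ge0; [lra|apply: mulr_ge0; [lra|exact: sqr_ge0]].
  have h3 : 0 <= (n - 8) * y ^+ 2 by apply: mulr_ge0; [nra|exact: sqr_ge0].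
  have := sqr_ge0 y; nra.
have d2_ge0 : 0 <= d2 by rewrite /d2 mulr_ge0 ?sqr_ge0 //; nra.
rewrite divr_ge0 //; last by apply: mulr_ge0; [lra|exact: sqr_ge0].
have q1' : 0 <= 1 - q by rewrite subr_ge0.
apply: addr_ge0; first apply: addr_ge0; apply: mulr_ge0 => //.
exact: mulr_ge0.
Qed.

(** A substitute for [n^(-1/8)] whose consecutive quotients are rational, so
    that sums against it telescope. *)
Definition decay (n : nat) : R := \prod_(j < n) (1 - (8 * j.+1%:R)^-1).

Lemma decay_factor_itv (m : R) (j : nat) :
  2 <= m -> 0 < 1 - (m * j.+1%:R)^-1 <= 1.
Proof.
move=> m2; have j1 : 1 <= j.+1%:R :> R by rewrite ler1n.
have mj : 2 <= m * j.+1%:R by nra.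
apply/andP; split; last by rewrite gerBl invr_ge0; lra.
by rewrite subr_gt0 invf_lt1; lra.
Qed.

Lemma decay_factor8 (j : nat) : 0 < 1 - (8 * j.+1%:R : R)^-1 <= 1.
Proof. by apply: decay_factor_itv; lra. Qed.

Lemma decayS n : decay n.+1 = decay n * (1 - (8 * n.+1%:R)^-1).
Proof. by rewrite /decay big_ord_recr. Qed.

Lemma decay_gt0 n : 0 < decay n.
Proof.
by apply: prodr_gt0 => j _; have /andP[] := decay_factor8 j.
Qed.

Lemma decay_le m n : (m <= n)%N -> decay n <= decay m.
Proof.
move=> /subnKC <-; elim: (n - m)%N => [|k IH]; first by rewrite addn0.
rewrite addnS decayS; apply: le_trans IH; apply: ler_piMr; first exact/ltW/decay_gt0.
by have /andP[] := decay_factor8 (m + k).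
Qed.

(** [C] does not depend on the damping [q]: the energy argument is uniform in
    [q] from the index 8 on, and the first iterates grow at most like [3^n]. *)
Lemma energy_decay : exists C : R, 0 < C /\ forall (q : R) (y z : nat -> R),
  0 <= q <= 1 -> y 0 = 1 -> z 0 = 0 ->
  (forall n, z n.+1 = q * z n - y n) ->
  (forall n, y n.+1 = y n + z n.+1 / n.+1%:R) ->
  forall n, `|y n| <= C * decay n.
Proof.
pose M : R := 3 ^+ 9; pose K := 4 * M ^+ 2 / decay 8 ^+ 2.
exists (2 * K + M / decay 8 + 1).
have M0 : 0 < M by rewrite exprn_gt0.
have d8 := decay_gt0 8.
have K0 : 0 <= K by rewrite divr_ge0 ?sqr_ge0 // mulr_ge0 ?sqr_ge0.
have C0 : 0 < 2 * K + M / decay 8 + 1.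
  have : 0 < M / decay 8 by rewrite divr_gt0.
  lra.
split=> // q y z q01 y0 z0 zS yS.
have bnd n : `|y n| <= 3 ^+ n /\ `|z n| <= 3 ^+ n.
  elim: n => [|n [IHy IHz]]; first by rewrite y0 z0 normr1 normr0.
  case/andP: q01 => q0 q1.
  have zb : `|z n.+1| <= 2 * 3 ^+ n.
    rewrite zS (le_trans (ler_normB _ _)) // normrM (ger0_norm q0).
    have : q * `|z n| <= 1 * `|z n| by rewrite ler_wpM2r.
    lra.
  split; last by rewrite (le_trans zb) // exprS ler_wpM2r ?exprn_ge0 //; lra.
  rewrite yS (le_trans (ler_normD _ _)) // normrM.
  have : `|z n.+1| * `|n.+1%:R^-1| <= `|z n.+1| * 1.
    by rewrite ler_wpM2l // ger0_norm ?invr_ge0 // invf_le1 ?ltr0n // ler1n.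
  rewrite exprS; lra.
have V8 k : energy (8 + k)%:R (y (8 + k)%N) (z (8 + k)%N) <= K * decay (8 + k) ^+ 2.
  elim: k => [|k IH].
    rewrite addn0 /K -mulrA mulVf ?mulr1; last by rewrite expf_neq0 // gt_eqF.
    have [yb zb] := bnd 8; rewrite /energy.
    have hM : 3 ^+ 8 <= M by rewrite /M exprS ler_peMl ?exprn_ge0 //; lra.
    have {}yb := le_trans yb hM; have {}zb := le_trans zb hM.
    have y2 : y 8 ^+ 2 <= M ^+ 2 by rewrite -real_normK ?num_real // lerXn2r ?nnegrE // ltW.
    have z2 : z 8 ^+ 2 <= M ^+ 2 by rewrite -real_normK ?num_real // lerXn2r ?nnegrE // ltW.
    have := sqr_ge0 (y 8 + z 8); have := sqr_ge0 (y 8); have := sqr_ge0 (z 8).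
    rewrite !expr2 in y2 z2 *; lra.
  rewrite addnS zS yS zS -addn1 natrD.
  apply: le_trans (energy_step _ _ _ _ _ q01) _; first by rewrite ler_nat leq_addr.
  rewrite addn1 decayS exprMn mulrA mulrC.
  set m : R := (8 + k)%:R + 1; have mE : (8 + k).+1%:R = m by rewrite -addn1 natrD.
  have m0 : 1 <= m by rewrite -mE ler1n.
  apply: le_trans (_ : K * decay (8 + k) ^+ 2 * (1 - (4 * m)^-1) <= _).
    apply: ler_wpM2r => //; rewrite subr_ge0 invf_le1; lra.
  apply: ler_wpM2l; first by rewrite mulr_ge0 ?sqr_ge0.
  (* [decay^2] shrinks no faster than the energy: [1 - 1/(4m) <= (1 - 1/(8m))^2] *)
  rewrite mE; have -> : (4 * m)^-1 = 2 * (8 * m)^-1 by field; lra.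
  have := sqr_ge0 (8 * m)^-1; rewrite !expr2; lra.
move=> n; have [n8|n8] := leqP 8 n.
  have := V8 (n - 8)%N; rewrite subnKC // => V.
  have := energy_ge n%:R (y n) (z n) _; rewrite ler1n (leq_trans _ n8) // => /(_ isT) yV.
  have Cd : 0 <= (2 * K + M / decay 8 + 1) * decay n.
    by apply: mulr_ge0; apply: ltW => //; exact: decay_gt0.
  rewrite -ler_sqr ?nnegrE // real_normK ?num_real //.
  have {}yV : y n ^+ 2 <= 2 * K * decay n ^+ 2 by rewrite -mulrA; lra.
  apply: le_trans yV _; rewrite exprMn ler_wpM2r ?sqr_ge0 //.
  have : 0 < M / decay 8 by rewrite divr_gt0.
  by move: (M / decay 8) => m m0; rewrite expr2; nra.
have dn : decay 8 <= decay n by exact/decay_le/ltnW.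
have [yb _] := bnd n; apply: le_trans yb _.
have : 3 ^+ n <= M by rewrite /M ler_weXn2l //; lra || rewrite ltnW // (ltn_trans n8).
move=> h; apply: le_trans h _.
have : M / decay 8 * decay 8 = M by rewrite divfK // gt_eqF.
move=> {1}<-; apply: ler_pM => //; first by rewrite divr_ge0 // ltW.
  exact: ltW.
lra.
Qed.

End Energy.

(** * Newton coefficients of the Gauss products *)

Section Meixner.
Context {R : realFieldType}.

(** The values at the naturals of [x |-> C(x + j, j) p^x]. *)
Definition bin_weight (p : R) (j i : nat) : R := 'C(i + j, j)%:R * p ^+ i.

(** Up to the sign [(-1)^n], the Newton coefficients of the Gauss product
    [C(x + N, N) (N + 1)^(-x)], which are values of a Meixner polynomial; they
    tend to [L_n(1)] when [N] grows. *)
Definition meixner (N n : nat) : R := bin_transform (bin_weight N.+1%:R^-1 N) n.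

Lemma bin_weightS p j i :
  i.+1%:R * bin_weight p j i.+1 = p * (i%:R + j.+1%:R) * bin_weight p j i.
Proof.
rewrite /bin_weight exprS.
have /(congr1 (fun m => m%:R : R)) : (i.+1 * 'C(i.+1 + j, j) = (i + j.+1) * 'C(i + j, j))%N.
  by have := mul_bin_down (i.+1 + j) j; rewrite addnK addSn /= addnS => <-.
rewrite !natrM natrD => e.
transitivity (p * p ^+ i * (i.+1%:R * 'C(i.+1 + j, j)%:R)); first by ring.
by rewrite e; ring.
Qed.

(** With [p = 1 / (N + 1)] the recurrence of the weights reads
    [(i + 1) w_(i+1) = p i w_i + w_i], and its transform is the damped equation
    of [energy_decay] with [q = 1 - p]. *)
Lemma meixner_decay : exists2 C : R, 0 < C &
  forall N n, `|meixner N n| <= C * decay n.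
Proof.
have [C [C0 HC]] := @energy_decay R; exists C => // N.
pose w := bin_weight N.+1%:R^-1 N; pose z n := bin_transform (fun i => i%:R * w i) n.
have N0 : N.+1%:R != 0 :> R by rewrite pnatr_eq0.
apply: (HC (1 - N.+1%:R^-1) _ z).
- by rewrite subr_ge0 gerBl invr_ge0 ler0n invf_le1 ?ltr0n // ler1n.
- by rewrite /meixner /bin_transform big_ord1 /bin_weight !bin0 binn !expr0 !mulr1.
- by rewrite /z /bin_transform big_ord1 mul0r mulr0.
- move=> n; rewrite /z bin_transformS.
  rewrite [X in _ - X](@bin_transform_eq _ _ (fun i => N.+1%:R^-1 * (i%:R * w i) + 1 * w i)).
    by rewrite bin_transform_lin /meixner -/w; ring.
  by move=> i /=; rewrite /w bin_weightS; field; rewrite addrC natr1.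
- move=> n; rewrite /z bin_transform_muln mulrC mulrA mulVf ?pnatr_eq0 // mul1r.
  by rewrite /meixner addrC subrK.
Qed.

End Meixner.

(** * Summability of Stirling numbers against the decay *)

Section Stirling.
Context {R : realFieldType}.
Local Notation stir n k := ((stirling1 n k)%:~R : R).

Lemma stirling1_0 k : stirling1 0 k = (k == 0)%:R.
Proof. by rewrite /stirling1 /falling_poly big_ord0 coef1. Qed.

Lemma stirling1S0 n : stirling1 n.+1 0 = - (n%:R * stirling1 n 0).
Proof.
rewrite /stirling1 /falling_poly big_ord_recr /= mulrBr coefB coefMX coefMC /=.
by rewrite sub0r mulrC.
Qed.

Lemma stirling1SS n k :
  stirling1 n.+1 k.+1 = stirling1 n k - n%:R * stirling1 n k.+1.
Proof.
rewrite /stirling1 /falling_poly big_ord_recr /= mulrBr coefB coefMX coefMC /=.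
by rewrite [in RHS]mulrC.
Qed.

(** The numbers [|s(n, k)|] are the coefficients of the rising factorial. *)
Lemma stirling1_norm_le (r : R) n k : 0 <= r ->
  `|stir n k| * r ^+ k <= \prod_(i < n) (r + i%:R).
Proof.
move=> r0; elim: n k => [|n IH] k.
  rewrite stirling1_0 big_ord0; case: k => [|k]; first by rewrite normr1 mulr1.
  by rewrite normr0 mul0r.
have P0 : 0 <= \prod_(i < n) (r + i%:R) by apply: prodr_ge0 => i _; rewrite addr_ge0.
rewrite big_ord_recr /= mulrDr; case: k => [|k].
  rewrite stirling1S0 rmorphN rmorphM /= normrN normrM mulr1 rmorph_nat.
  rewrite -[X in X <= _]add0r lerD ?mulr_ge0 // normr_nat mulrC ler_wpM2r //.
  by have := IH 0; rewrite mulr1.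
rewrite stirling1SS rmorphB rmorphM /= rmorph_nat.
apply: le_trans (_ : (`|stir n k| + n%:R * `|stir n k.+1|) * r ^+ k.+1 <= _).
  rewrite ler_wpM2r ?exprn_ge0 // (le_trans (ler_normB _ _)) // normrM.
  by rewrite normr_nat.
rewrite mulrDl; apply: lerD.
  by rewrite exprSr mulrA ler_wpM2r.
by rewrite -mulrA mulrC ler_wpM2r.
Qed.

(* Any base below the decay exponent 1/8 would do: with 1/16 the products
   [decay n * rise n] stay below increments of the decreasing sequence [h]. *)
Let rise n : R := (\prod_(i < n) (16^-1 + i%:R)) / n`!%:R.
Let h n : R := \prod_(j < n) (1 - (16 * j.+1%:R)^-1).

Let h_itv n : 0 <= h n <= 1.
Proof.
rewrite /h; elim: n => [|n /andP[h0 h1]]; first by rewrite big_ord0 ler01 lexx.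
rewrite big_ord_recr /=; have /andP[a b] := @decay_factor_itv R 16 n ltac:(lra).
by rewrite mulr_ge0 ?mulr_ile1 // ltW.
Qed.

Let riseS n : rise n.+1 = rise n * ((16^-1 + n%:R) / n.+1%:R).
Proof.
rewrite /rise big_ord_recr /= factS natrM; field.
by rewrite !pnatr_eq0 /= -lt0n fact_gt0 andbT addrC natr1 pnatr_eq0.
Qed.

Let decay_rise n : decay n * rise n.+1 <= h n - h n.+1.
Proof.
have -> : h n - h n.+1 = h n / (16 * n.+1%:R).
  by rewrite /h big_ord_recr /=; ring.
elim: n => [|n IH].
  rewrite riseS /rise /h /decay !big_ord0 fact0; lra.
have -> : h n.+1 = h n * (1 - (16 * n.+1%:R)^-1) by rewrite /h big_ord_recr.
rewrite decayS riseS.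
set m : R := n.+1%:R; have m1 : 1 <= m by rewrite ler1n.
have -> : n.+2%:R = m + 1 by rewrite natr1.
apply: le_trans (_ : h n / (16 * m) *
   ((1 - (8 * m)^-1) * ((16^-1 + m) / (m + 1))) <= _).
  rewrite mulrACA ler_wpM2r // mulr_ge0 //.
    by rewrite subr_ge0 invf_le1; lra.
  by rewrite divr_ge0 //; lra.
have /andP[h0 _] := h_itv n.
rewrite -!mulrA ler_wpM2l // -subr_ge0.
rewrite (_ : _ - _ = (16 * 8 * 16 * m ^+ 2 * (m + 1))^-1).
  by rewrite invr_ge0; nra.
by field; lra.
Qed.

(** [|s(n, k)| / n!] grows like [(log n)^(k - 1) / n], whose sum just diverges;
    bounding it by [16^k rise n] turns the product with [decay] into
    telescoping increments. *)
Lemma sum_stirling_decay k :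
  exists B : R, forall M, series (fun n => `|stir n k| / n`!%:R * decay n) M <= B.
Proof.
exists (2 * 16 ^+ k) => M.
have key n : `|stir n k| / n`!%:R * decay n <= 16 ^+ k * (rise n * decay n).
  rewrite mulrA ler_wpM2r ?(ltW (decay_gt0 _)) // /rise mulrA ler_wpM2r ?invr_ge0 //.
  have := @stirling1_norm_le 16^-1 n k; rewrite invr_ge0 ler0n => /(_ isT).
  by rewrite exprVn ler_pdivrMr ?exprn_gt0 // mulrC.
apply: le_trans (_ : 16 ^+ k * (\sum_(0 <= n < M) rise n * decay n) <= _).
  by rewrite mulr_sumr /series /=; apply: ler_sum => n _; exact: key.
rewrite mulrC ler_wpM2r ?exprn_ge0 //.
have e n : \sum_(0 <= i < n.+1) rise i * decay i <= 1 + (h 0 - h n).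
  elim: n => [|n IH].
    by rewrite big_nat1 /rise /decay !big_ord0 fact0 subrr addr0 divr1 mulr1.
  rewrite big_nat_recr //=.
  have : rise n.+1 * decay n.+1 <= h n - h n.+1.
    apply: le_trans (decay_rise n); rewrite mulrC ler_wpM2r ?decay_le //.
    by rewrite divr_ge0 // prodr_ge0 // => i _; rewrite addr_ge0 ?invr_ge0.
  lra.
case: M => [|M]; first by rewrite big_geq.
apply: le_trans (e M) _; have /andP[a b] := h_itv M; have /andP[_ c] := h_itv 0; lra.
Qed.

End Stirling.

(** * Dominated convergence for series *)

Section Tannery.
Context {R : realType}.

Lemma bounded_series_cvg (g : nat -> R) B :
  (forall n, 0 <= g n) -> (forall M, series g M <= B) -> cvgn (series g).
Proof.
move=> g0 gB; apply: nondecreasing_is_cvgn.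
  by apply/nondecreasing_seqP => n; rewrite seriesSr lerDl.
by exists B => _ [n _ <-].
Qed.

Lemma dominated_series_cvg (f g : nat -> R) :
  (forall n, `|f n| <= g n) -> cvgn (series g) -> cvgn (series f).
Proof.
move=> fg cg; apply: normed_cvg.
apply: (series_le_cvg _ _ _ cg) => n; [exact: normr_ge0|exact: le_trans (normr_ge0 _) (fg n)|exact: fg].
Qed.

Lemma dominated_series_tail (f g : nat -> R) (s : R) M :
  (forall n, `|f n| <= g n) -> cvgn (series g) ->
  series f @ \oo --> s -> `|s - series f M| <= limn (series g) - series g M.
Proof.
move=> fg cg fs.
have cvl : (fun P => `|series f P - series f M|) @ \oo --> `|s - series f M|.
  by apply: cvg_norm; apply: cvgB => //; exact: cvg_cst.
have cvr : (fun P => series g P - series g M) @ \oo --> limn (series g) - series g M.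
  by apply: cvgB => //; exact: cvg_cst.
apply: ler_cvg_to cvl cvr _; near=> P.
have MP : (M <= P)%N by near: P; exact: nbhs_infty_ge.
rewrite !sub_series MP.
apply: le_trans (ler_norm_sum _ _ _) _; exact: ler_sum.
Unshelve. all: by end_near. Qed.

(** Tannery's theorem. *)
Lemma tannery (f : nat -> nat -> R) (F g s : nat -> R) :
  (forall N n, `|f N n| <= g n) -> cvgn (series g) ->
  (forall n, f N n @[N --> \oo] --> F n) ->
  (forall N, series (f N) @ \oo --> s N) ->
  cvgn (series F) /\ s @ \oo --> limn (series F).
Proof.
move=> fg cg fF fs.
have Fg n : `|F n| <= g n.
  by apply: (cvgr_to_le (cvg_norm (fF n))); exact: nearW.
have cF := dominated_series_cvg _ _ Fg cg; split => //.
apply/cvgrPdist_lt => e e0.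
have e3 : 0 < e / 3 by lra.
have [M HM] : exists M, limn (series g) - series g M < e / 3.
  have /cvgrPdist_lt/(_ _ e3)[M _ HM] : series g @ \oo --> limn (series g) by [].
  by exists M; exact: le_lt_trans (ler_norm _) (HM M (leqnn M)).
have cM : series (f N) M @[N --> \oo] --> series F M.
  rewrite /series /=; apply: cvg_big => [|i _]; last exact: fF.
  exact: add_continuous.
near=> N.
have hN : `|series F M - series (f N) M| < e / 3.
  by near: N; move/cvgrPdist_lt: cM; exact.
have h1 := dominated_series_tail _ _ _ M Fg cg cF.
have h2 := dominated_series_tail _ _ _ M (fg N) cg (fs N).
move: hN h1 h2 HM; set T := limn (series g) - _; set A := limn (series F).
move=> hN h1 h2 HT.
have -> : A - s N = (A - series F M) + (series F M - series (f N) M) - (s N - series (f N) M) by ring.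
have := ler_normB ((A - series F M) + (series F M - series (f N) M)) (s N - series (f N) M).
have := ler_normD (A - series F M) (series F M - series (f N) M).
lra.
Unshelve. all: by end_near. Qed.

End Tannery.

(** * Geometric bounds *)

Section Geometric.
Context {R : realType}.

(** A polynomial factor is absorbed by enlarging the ratio; the constant comes
    from Bernoulli's inequality [1 + n x <= (1 + x)^n]. *)
Lemma muln_geometric (rho : R) : 0 < rho < 1 ->
  exists C s : R, [/\ 0 < C, 0 < s < 1 & forall n, n.+1%:R * rho ^+ n <= C * s ^+ n].
Proof.
move=> /andP[r0 r1]; pose s := (1 + rho) / 2; pose x := s / rho - 1.
have s01 : 0 < s < 1 by rewrite /s; lra.
have x0 : 0 < x by rewrite subr_gt0 ltr_pdivlMr // /s; lra.
have xx : 0 < x^-1 by rewrite invr_gt0.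
exists (1 + x^-1), s; split => //; first by lra.
have bern n : 1 + n%:R * x <= (1 + x) ^+ n.
  elim: n => [|n IH]; first by rewrite mul0r addr0 expr0.
  rewrite exprS -natr1.
  have h : (1 + x) * (1 + n%:R * x) <= (1 + x) * (1 + x) ^+ n by rewrite ler_wpM2l //; lra.
  have := ler0n R n; nra.
move=> n; have -> : s ^+ n = (1 + x) ^+ n * rho ^+ n.
  by rewrite -exprMn addrC subrK divfK // gt_eqF.
rewrite mulrA ler_wpM2r ?exprn_ge0 ?(ltW r0) //.
apply: le_trans (_ : (1 + x^-1) * (1 + n%:R * x) <= _); last first.
  by rewrite ler_wpM2l //; lra.
have -> : (1 + x^-1) * (1 + n%:R * x) = 1 + n%:R + (x^-1 + n%:R * x) by field; rewrite gt_eqF.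
by rewrite -natr1 addrC lerDl addr_ge0 ?(ltW xx) // mulr_ge0 ?ler0n ?(ltW x0).
Qed.

Lemma geometric_bound_series_cvg (u : nat -> R) C rho : 0 < rho < 1 ->
  (forall n, `|u n| <= C * rho ^+ n) -> cvgn (series u).
Proof.
move=> /andP[r0 r1] ub; apply: dominated_series_cvg ub _.
by apply: is_cvg_geometric_series; rewrite ger0_norm // ltW.
Qed.

End Geometric.

(** * From Newton series to power series *)

Definition exp_term {K : numFieldType} (a : K) (k : nat) : K := a ^+ k / k`!%:R.

Section NewtonToPower.
Context {R : realType}.
Local Notation stir n k := ((stirling1 n k)%:~R : R).

(** The coefficients of [(1 + a X) c]. *)
Definition mul_linear (a : R) (c : nat -> R) (k : nat) : R :=
  c k + (if k is k'.+1 then a * c k' else 0).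

(** The Taylor coefficients of [exp(lam x) (1 + x) (1 + x/2) ... (1 + x/j)]. *)
Fixpoint prod_exp_coef (j : nat) (lam : R) : nat -> R :=
  if j is j'.+1 then mul_linear (j'.+1%:R)^-1 (prod_exp_coef j' lam) else exp_term lam.

Lemma stirling1_fact_le n k : `|stir n k| <= n`!%:R.
Proof.
have := @stirling1_norm_le R 1 n k ler01; rewrite expr1n mulr1 => h.
apply: le_trans h _; rewrite fact_prod natr_prod big_add1 big_mkord.
by apply: ler_prod => i _; rewrite addr_ge0 //= addrC natr1.
Qed.

Lemma stirling1_div_fact_le n k : `|stir n k| / n`!%:R <= 1.
Proof. by rewrite ler_pdivrMr ?mul1r ?stirling1_fact_le // ltr0n fact_gt0. Qed.

(** The coefficient of [x^k q^n] in [(1 - q)^x]. *)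
Definition stirling_term (k n : nat) : R := (-1) ^+ n * stir n k / n`!%:R.

Lemma stirling_term_le k n : `|stirling_term k n| <= 1.
Proof.
by rewrite /stirling_term !normrM normrX normrN1 expr1n mul1r normfV normr_nat stirling1_div_fact_le.
Qed.

Lemma stirling_term0 k : stirling_term k 0 = (k == 0)%:R.
Proof. by rewrite /stirling_term stirling1_0 fact0 divr1 mul1r rmorph_nat. Qed.

Lemma stirling_term_0S n : stirling_term 0 n.+1 = 0.
Proof.
rewrite /stirling_term; suff -> : stirling1 n.+1 0 = 0 by rewrite mulr0 mul0r.
by elim: n => [|n IH]; rewrite stirling1S0 ?mul0r ?oppr0 // IH mulr0 oppr0.
Qed.

Lemma stirling_termS k n : n.+1%:R * stirling_term k.+1 n.+1 = n%:R * stirling_term k.+1 n - stirling_term k n.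
Proof.
rewrite /stirling_term stirling1SS factS natrM rmorphB rmorphM /= rmorph_nat exprS; field.
by rewrite pnatr_eq0 -lt0n fact_gt0 /= addrC natr1 pnatr_eq0.
Qed.

Let genf k (x : R) : R := limn (pseries (stirling_term k) x).

Let genf_cvg k (x : R) : `|x| < 1 -> [/\ cvgn (pseries (stirling_term k) x),
  cvgn (pseries (pseries_diffs (stirling_term k)) x) &
  cvgn (pseries (pseries_diffs (pseries_diffs (stirling_term k))) x)].
Proof.
move=> x1; pose y := (1 + `|x|) / 2.
have y01 : 0 < y < 1 by have := normr_ge0 x; rewrite /y; lra.
have [C1 [s1 [C10 s11 H1]]] := muln_geometric _ y01.
have [C2 [s2 [C20 s21 H2]]] := muln_geometric _ s11.
have [C3 [s3 [C30 s31 H3]]] := muln_geometric _ s21.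
have xy n : `|x ^+ n| <= y ^+ n.
  by rewrite normrX lerXn2r ?nnegrE ?normr_ge0 //; rewrite /y; have := normr_ge0 x; lra.
have y0 n : 0 <= y ^+ n by case/andP: y01 => /ltW h _; rewrite exprn_ge0.
split.
- apply: (geometric_bound_series_cvg _ 1 y y01) => n.
  by rewrite normrM ler_pM // stirling_term_le.
- apply: (geometric_bound_series_cvg _ C1 s1 s11) => n.
  apply: le_trans (H1 n); rewrite /pseries_diffs normrM [`|n.+1%:R * _|]normrM normr_nat.
  apply: ler_pM => //.
  by rewrite ler_piMr // stirling_term_le.
- apply: (geometric_bound_series_cvg _ (2 * C1 * C2) s2 s21) => n.
  rewrite /pseries_diffs normrM [`|n.+1%:R * _|]normrM [`|n.+2%:R * _|]normrM !normr_nat.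
  apply: le_trans (_ : n.+1%:R * (2 * n.+1%:R * 1) * y ^+ n <= _).
    apply: ler_pM => //.
    rewrite ler_wpM2l //; apply: ler_pM => //; last exact: stirling_term_le.
    by rewrite -natrM ler_nat mul2n -addnn addSnnS leq_addl.
  have -> : n.+1%:R * (2 * n.+1%:R * 1) * y ^+ n = 2 * n.+1%:R * (n.+1%:R * y ^+ n) by ring.
  apply: le_trans (_ : 2 * n.+1%:R * (C1 * s1 ^+ n) <= _).
    by rewrite ler_wpM2l // mulr_ge0.
  have -> : 2 * n.+1%:R * (C1 * s1 ^+ n) = 2 * C1 * (n.+1%:R * s1 ^+ n) by ring.
  by rewrite -[leRHS]mulrA ler_wpM2l // mulr_ge0 // ltW.
Qed.

Let is_derive_genf k (x : R) : `|x| < 1 ->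
  is_derive x 1 (genf k) (limn (pseries (pseries_diffs (stirling_term k)) x)).
Proof.
move=> x1; pose y := (1 + `|x|) / 2.
have y1 : `|y| < 1 by rewrite ger0_norm; have := normr_ge0 x; rewrite /y; lra.
have [c1 c2 c3] := genf_cvg k _ y1.
apply: pseries_snd_diffs c1 c2 c3 _.
by rewrite [ltRHS]ger0_norm; have := normr_ge0 x; rewrite /y; lra.
Qed.

Let genf_at0 k : genf k 0 = (k == 0)%:R.
Proof.
rewrite /genf; apply/cvg_lim => //; apply: cvg_near_cst; exists 1 => // n /= n0.
rewrite /pseries /series /= -(prednK n0) big_nat_recl //= expr0 mulr1 stirling_term0.
by rewrite big1 ?addr0 // => i _; rewrite expr0n mulr0.
Qed.

Let genf_0 x : genf 0 x = 1.
Proof.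
rewrite /genf; apply/cvg_lim => //; apply: cvg_near_cst; exists 1 => // n /= n0.
rewrite /pseries /series /= -(prednK n0) big_nat_recl //= expr0 mulr1 stirling_term0 eqxx.
by rewrite big1 ?addr0 // => i _; rewrite stirling_term_0S mul0r.
Qed.

(* The recurrence of the Stirling numbers, summed: the differential equation
   satisfied by [ln (1 - x)^(k+1) / (k+1)!]. *)
Let genf_ode k (x : R) : `|x| < 1 ->
  (1 - x) * limn (pseries (pseries_diffs (stirling_term k.+1)) x) = - genf k x.
Proof.
move=> x1; have [c1 c2 _] := genf_cvg k.+1 _ x1; have [c3 _ _] := genf_cvg k _ x1.
pose D := limn (pseries (pseries_diffs (stirling_term k.+1)) x).
pose eqv : R^nat := fun n => n%:R * stirling_term k.+1 n * x ^+ n.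
have e1 : series eqv @ \oo --> x * D.
  rewrite -[X in X @ _]/(series eqv) -cvg_shiftS.
  rewrite (_ : [sequence _]_n = (fun n => x * pseries (pseries_diffs (stirling_term k.+1)) x n)).
    by apply: cvgM => //; exact: cvg_cst.
  apply/funext => n /=; rewrite /series /= big_nat_recl //= /eqv !mul0r add0r.
  rewrite /pseries /series /= mulr_sumr; apply: eq_bigr => i _.
  by rewrite /pseries_diffs exprS; ring.
have e2 : series eqv \- pseries (stirling_term k) x = pseries (pseries_diffs (stirling_term k.+1)) x.
  apply/funext => n; rewrite /pseries /series /= -sumrB; apply: eq_bigr => i _.
  by rewrite /pseries_diffs stirling_termS /eqv; ring.
have e3 : series eqv \- pseries (stirling_term k) x @ \oo --> x * D - genf k x by apply: cvgB.
rewrite e2 in e3; have {}e3 : D = x * D - genf k x by apply/cvg_lim.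
by rewrite -/D mulrBl mul1r {1}e3 addrAC subrr add0r.
Qed.

Lemma is_derive_exp_term_ln k (x : R) : x < 1 ->
  is_derive x 1 (fun x => exp_term (ln (1 - x)) k.+1) (- ((1 - x)^-1 * exp_term (ln (1 - x)) k)).
Proof.
move=> x1; have x0 : 0 < 1 - x by rewrite subr_gt0.
have d1 : is_derive x 1 (fun x : R => 1 - x) (-1).
  have -> : (fun x : R => 1 - x) = cst 1 - id by apply/funext.
  by apply: is_derive_eq; rewrite add0r.
have d2 : is_derive (1 - x) 1 (@ln R) (1 - x)^-1 by exact: is_derive1_ln.
have d3 : is_derive x 1 (@ln R \o (fun x : R => 1 - x)) ((1 - x)^-1 * -1).
  exact: is_derive1_comp.
have d4 : is_derive x 1 ((@ln R \o (fun x : R => 1 - x)) ^+ k.+1)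
    ((k.+1%:R * ln (1 - x) ^+ k) *: ((1 - x)^-1 * -1)) by exact: is_deriveX.
have d5 := is_deriveZ ((k.+1)`!%:R^-1) d4.
rewrite (_ : (fun _ => _) = (k.+1)`!%:R^-1 \*: (@ln R \o (fun x : R => 1 - x)) ^+ k.+1); last first.
  by apply/funext => y; rewrite /exp_term mulrC /= exprfctE.
apply: (is_derive_eq d5); rewrite /exp_term factS natrM /= /GRing.scale /=.
have : k`!%:R != 0 :> R by rewrite pnatr_eq0 -lt0n fact_gt0.
have : k.+1%:R != 0 :> R by rewrite pnatr_eq0.
have : 1 - x != 0 by rewrite gt_eqF.
move: (1 - x) (k.+1%:R : R) (k`!%:R : R) (ln _ ^+ k) => a b c d a0 b0 c0.
by field; rewrite a0 b0 c0.
Qed.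

Let genf_ln k (q : R) : 0 <= q < 1 -> genf k q = exp_term (ln (1 - q)) k.
Proof.
elim: k q => [|k IH] q /andP[q0 q1]; first by rewrite genf_0 /exp_term fact0 divr1.
pose D (x : R) : R := genf k.+1 x - exp_term (ln (1 - x)) k.+1.
have dD (x : R) : 0 <= x < 1 -> is_derive x 1 D 0.
  move=> /andP[x0 x1]; have x1' : `|x| < 1 by rewrite ger0_norm.
  have dP := is_derive_genf k.+1 _ x1'; have dF := is_derive_exp_term_ln k _ x1.
  apply: (is_derive_eq (is_deriveB dP dF)).
  have := genf_ode k _ x1'; rewrite IH ?x0 // => /(canRL (mulKf _)) ->; last by lra.
  by rewrite opprK mulrN addNr.
have : D q - D 0 = 0 * (q - 0).
  have [||c _ ->] := @MVT_segment R D (fun=> 0) 0 q q0.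
  - by move=> x; rewrite in_itv /= => /andP[x0 xq]; apply: dD; rewrite ltW ?(lt_trans xq).
  - apply: derivable_within_continuous => x; rewrite in_itv /= => /andP[x0 xq].
    by have [] := dD x _; rewrite ?x0 ?(le_lt_trans xq).
  - by [].
rewrite mul0r /D genf_at0 /= subr0 ln1 /exp_term expr0n mul0r !subr0 => /eqP.
by rewrite subr_eq0 => /eqP.
Qed.

(** The exponential generating function of the Stirling numbers: both sides
    satisfy the same differential equation in [q]. *)
Lemma series_stirling_term_geometric k (q : R) : 0 <= q < 1 ->
  series (fun n => stirling_term k n * q ^+ n) @ \oo --> exp_term (ln (1 - q)) k.
Proof.
move=> q01; rewrite -(genf_ln _ _ q01).
by have [] := genf_cvg k q _; rewrite // ger0_norm; case/andP: q01.
Qed.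

Lemma bin_transform_bin_weight0 (p : R) n : bin_transform (bin_weight p 0) n = (1 - p) ^+ n.
Proof.
rewrite exprBn /bin_transform; apply: eq_bigr => i _.
by rewrite /bin_weight addn0 bin0 expr1n -mulr_natr; ring.
Qed.

Lemma bin_weight_next (p : R) j i :
  bin_weight p j.+1 i = 1 * bin_weight p j i + j.+1%:R^-1 * (i%:R * bin_weight p j i).
Proof.
rewrite /bin_weight.
have /(congr1 (fun m => m%:R : R)) : (j.+1 * 'C(i + j.+1, j.+1) = (i + j.+1) * 'C(i + j, j))%N.
  by rewrite -mul_bin_diag addnS.
rewrite !natrM natrD => e; apply: (mulfI (_ : j.+1%:R != 0)); first by rewrite pnatr_eq0.
rewrite [LHS]mulrA e !mulrDr [in RHS](mulrA j.+1%:R j.+1%:R^-1) mulfV ?pnatr_eq0 //.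
by rewrite -natr1; ring.
Qed.

(** Multiplying a function by [1 + x/(j+1)], seen on its Newton coefficients. *)
Lemma bin_transform_bin_weightS (p : R) j n : bin_transform (bin_weight p j.+1) n.+1 =
  bin_transform (bin_weight p j) n.+1 +
  n.+1%:R / j.+1%:R * (bin_transform (bin_weight p j) n.+1 - bin_transform (bin_weight p j) n).
Proof.
rewrite (bin_transform_eq _ (bin_weight_next p j)) bin_transform_lin bin_transform_muln mul1r; congr (_ + _).
by ring.
Qed.

Lemma bin_transform_0 (w : nat -> R) : bin_transform w 0 = w 0.
Proof. by rewrite /bin_transform big_ord1 bin0 !mul1r. Qed.

Lemma bin_weight_0 (p : R) j : bin_weight p j 0 = 1.
Proof. by rewrite /bin_weight add0n binn mul1r. Qed.

Lemma bin_transform_bin_weight_geometric (p : R) j : 0 < p < 1 ->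
  exists C s : R, [/\ 0 < C, 0 < s < 1 & forall n, `|bin_transform (bin_weight p j) n| <= C * s ^+ n].
Proof.
move=> p01; elim: j => [|j [C [s [C0 s01 IH]]]].
  exists 1, (1 - p); split => //; first by lra.
  by move=> n; rewrite bin_transform_bin_weight0 mul1r ger0_norm // exprn_ge0 //; lra.
have [C' [t [C0' t01 H]]] := muln_geometric _ s01.
have [/andP[s0 s1] /andP[t0 t1]] := (s01, t01).
exists (C' * (2 * C / s) + 1), t; split => //.
  by rewrite addr_gt0 // !mulr_gt0 // invr_gt0.
case=> [|n].
  rewrite bin_transform_0 bin_weight_0 normr1 expr0 mulr1 lerDr.
  by rewrite !mulr_ge0 ?invr_ge0 ?ler0n ?(ltW C0) ?(ltW C0') ?(ltW s0).
rewrite bin_transform_bin_weightS; set a := bin_transform _ _; set b := bin_transform _ n.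
have ab : `|a| <= C * s ^+ n.+1 by exact: IH.
have bb : `|b| <= C * s ^+ n by exact: IH.
set m : R := n.+1%:R / j.+1%:R.
have m0 : 0 <= m by rewrite divr_ge0.
have mn : m <= n.+1%:R.
  by rewrite ler_pdivrMr ?ltr0n // ler_peMr // ler1n.
have sn : 0 <= s ^+ n by rewrite exprn_ge0 // ltW.
have asn : `|a| <= C * s ^+ n.
  by apply: le_trans ab _; rewrite exprS ler_wpM2l ?(ltW C0) // ler_piMl // ltW.
have n1 : n.+2%:R = n.+1%:R + 1 :> R by rewrite natr1.
apply: le_trans (_ : n.+2%:R * (2 * C / s * s ^+ n.+1) <= _); last first.
  apply: le_trans (_ : C' * (2 * C / s) * t ^+ n.+1 <= _); last first.
    by rewrite [leRHS]mulrDl lerDl mul1r exprn_ge0 // ltW.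
  rewrite mulrCA [leRHS]mulrAC [leRHS]mulrC; apply: ler_wpM2l; last exact: H.
  by rewrite !mulr_ge0 ?invr_ge0 ?(ltW C0) ?(ltW s0).
have -> : 2 * C / s * s ^+ n.+1 = 2 * (C * s ^+ n) by rewrite exprS; field; rewrite gt_eqF.
apply: le_trans (ler_normD _ _) _; rewrite normrM (ger0_norm m0).
have h : m * `|a - b| <= n.+1%:R * (2 * (C * s ^+ n)).
  by apply: ler_pM => //; have := ler_normB a b; lra.
have : 0 <= C * s ^+ n by rewrite mulr_ge0 // ltW.
by rewrite n1; lra.
Qed.

(** Re-expanding the Newton series of [C(x + j, j) p^x] in powers of [x]. The
    induction on [j] multiplies by [1 + x/(j+1)] on both sides; on partial sums
    this is an identity up to a boundary term. *)
Lemma newton_to_power (p : R) j k : 0 < p < 1 ->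
  series (fun n => stirling_term k n * bin_transform (bin_weight p j) n) @ \oo --> prod_exp_coef j (ln p) k.
Proof.
move=> p01; elim: j k => [|j IH] k.
  rewrite (_ : (fun _ => _) = (fun n => stirling_term k n * (1 - p) ^+ n)).
    have := series_stirling_term_geometric k (1 - p); rewrite subKr; apply; lra.
  by apply/funext => n; rewrite bin_transform_bin_weight0.
case: k => [|k].
  have -> : prod_exp_coef j.+1 (ln p) 0 = prod_exp_coef j (ln p) 0 by rewrite /= /mul_linear addr0.
  rewrite (_ : (fun _ => _) = (fun n => stirling_term 0 n * bin_transform (bin_weight p j) n)) //.
  by apply/funext => -[|n]; rewrite ?stirling_term_0S ?mul0r // !bin_transform_0 !bin_weight_0.
(* the boundary term, which vanishes in the limit by the geometric decay *)
pose b M : R := M%:R * stirling_term k.+1 M * bin_transform (bin_weight p j) M.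
have E M : series (fun n => stirling_term k.+1 n * bin_transform (bin_weight p j.+1) n) M.+1 =
  series (fun n => stirling_term k.+1 n * bin_transform (bin_weight p j) n) M.+1 +
  j.+1%:R^-1 * (series (fun n => stirling_term k n * bin_transform (bin_weight p j) n) M + b M).
  elim: M => [|M IHM].
    rewrite /series /= !big_nat1 big_geq // /b !mul0r addr0 mulr0 addr0.
    by rewrite !bin_transform_0 !bin_weight_0.
  rewrite seriesSr IHM [in RHS]seriesSr [series _ M.+1 in X in _ = _ + X]seriesSr.
  rewrite bin_transform_bin_weightS /b.
  have := stirling_termS k M; set u := bin_transform _ M.+1; set v := bin_transform _ M => e.
  have {}e : stirling_term k M = M%:R * stirling_term k.+1 M - M.+1%:R * stirling_term k.+1 M.+1 by rewrite e; ring.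
  by rewrite e; ring.
rewrite -cvg_shiftS /= /mul_linear; under eq_cvg do rewrite E.
apply: cvgD; first by rewrite (cvg_shiftS (series _)); exact: IH.
apply: cvgM; first exact: cvg_cst.
rewrite -[X in _ --> X]addr0; apply: cvgD; first exact: IH.
have [C [s [C0 s01 H]]] := bin_transform_bin_weight_geometric p j p01.
have [C' [t [C0' t01 H']]] := muln_geometric _ s01.
apply: cvg_series_cvg_0; apply: (geometric_bound_series_cvg _ (C * C') t t01) => n.
rewrite /b normrM [`|n%:R * _|]normrM normr_nat.
apply: le_trans (_ : n.+1%:R * 1 * (C * s ^+ n) <= _).
  apply: ler_pM => //; apply: ler_pM => //; last exact: stirling_term_le.
  by rewrite ler_nat.
have -> : n.+1%:R * 1 * (C * s ^+ n) = C * (n.+1%:R * s ^+ n) by ring.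
by rewrite -mulrA ler_wpM2l // ltW.
Qed.

End NewtonToPower.

(** * The coefficients as limits *)

Section Coefficients.
Context {R : realType}.

Definition laguerre1 (n : nat) : R := bin_transform (fun i => i`!%:R^-1) n.

Lemma ratr_rgamma_term k n : ratr (rgamma_term k n) = stirling_term k n * laguerre1 n :> R.
Proof.
rewrite /rgamma_term /stirling_term /laguerre1 /laguerre horner_poly !rmorphM /= rmorphXn rmorphN rmorph1 /=.
rewrite ratr_int fmorphV /= ratr_nat rmorph_sum /=.
rewrite [X in _ * (X * _)](_ : _ = bin_transform (fun i => i`!%:R^-1) n); first by ring.
apply: eq_bigr => j _; rewrite expr1n mulr1 !rmorphM /= rmorphXn rmorphN rmorph1 /=.
by rewrite fmorphV /= !ratr_nat; ring.
Qed.

Lemma cvg_bin_weight i :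
  bin_weight N.+1%:R^-1 N i @[N --> \oo] --> (i`!%:R^-1 : R).
Proof.
elim: i => [|i IH].
  by apply: cvg_near_cst; apply: nearW => N; rewrite bin_weight_0 fact0 invr1.
have E (N : nat) : bin_weight N.+1%:R^-1 N i.+1 =
    i.+1%:R^-1 * ((i%:R * N.+1%:R^-1 + 1) * bin_weight N.+1%:R^-1 N i) :> R.
  apply: (mulfI (_ : i.+1%:R != 0)); first by rewrite pnatr_eq0.
  rewrite bin_weightS mulVKf ?pnatr_eq0 //; congr (_ * _).
  by rewrite mulrDr mulVf ?pnatr_eq0 // mulrC.
under eq_cvg do rewrite E.
rewrite factS natrM invfM; apply: cvgM; first exact: cvg_cst.
rewrite -[X in _ --> X]mul1r; apply: cvgM IH.
rewrite -[X in _ --> X]add0r; apply: cvgD; last exact: cvg_cst.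
rewrite -[X in _ --> X](mulr0 i%:R); apply: cvgM; first exact: cvg_cst.
exact: cvg_harmonic.
Qed.

Lemma cvg_meixner n : meixner N n @[N --> \oo] --> laguerre1 n.
Proof.
apply: cvg_big => [|i _]; first exact: add_continuous.
by apply: cvgM; [exact: cvg_cst|exact: cvg_bin_weight].
Qed.

(** The Taylor coefficients of the Gauss product
    [C(x + N + 1, N + 1) (N + 2)^(-x)]; starting at [N + 1] makes
    [1 / (N + 2)] smaller than [1]. *)
Definition gauss_coef (N k : nat) : R := prod_exp_coef N.+1 (ln N.+2%:R^-1) k.

(** Dominated convergence in [newton_to_power]: the Newton coefficients converge
    to those of the series for [a_k] and are bounded uniformly in [N] by
    [meixner_decay], against which the Stirling factors are summable. *)
Lemma rgamma_coef_cvg k :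
  cvgn (series (fun n => ratr (rgamma_term k n) : R)) /\
  gauss_coef ^~ k @ \oo --> rgamma_coef R k.
Proof.
have [C C0 HC] := @meixner_decay R; have [B HB] := @sum_stirling_decay R k.
rewrite /rgamma_coef (_ : (fun n => ratr _) = (fun n => stirling_term k n * laguerre1 n)); last first.
  by apply/funext => n; exact: ratr_rgamma_term.
pose g n : R := C * (`|(stirling1 n k)%:~R| / n`!%:R * decay n).
have g0 n : 0 <= g n.
  by rewrite mulr_ge0 ?(ltW C0) // mulr_ge0 ?(ltW (decay_gt0 _)) // divr_ge0.
apply: (tannery (fun N n => stirling_term k n * meixner N.+1 n) _ g).
- move=> N n; rewrite normrM /g mulrCA /stirling_term !normrM normrX normrN1 expr1n mul1r.
  by rewrite normfV normr_nat ler_wpM2l // divr_ge0.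
- apply: (bounded_series_cvg _ (C * B) g0) => M.
  rewrite /g /series /= -mulr_sumr ler_wpM2l ?(ltW C0) //; exact: HB.
- move=> n; apply: cvgM; first exact: cvg_cst.
  by rewrite (cvg_shiftS (fun N => meixner N n)); exact: cvg_meixner.
- move=> N; apply: newton_to_power.
  by rewrite invr_gt0 ltr0n invf_lt1 ?ltr0n // ltr1n.
Qed.

End Coefficients.

(** * Coefficientwise majorants *)

Section Convolution.
Context {R : comNzRingType}.
Implicit Types (c d : nat -> R) (a : R).

Definition conv c d k : R := \sum_(i < k.+1) c i * d (k - i)%N.

Lemma sum_conv c d n :
  \sum_(k < n) conv c d k = \sum_(i < n) \sum_(j < n - i) c i * d j.
Proof.
elim: n => [|n IH]; first by rewrite !big_ord0.
rewrite big_ord_recr /= IH [RHS]big_ord_recr /= subSnn big_ord1.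
rewrite /conv big_ord_recr /= subnn addrA; congr (_ + _).
rewrite -big_split; apply: eq_bigr => i _ /=.
by rewrite subSn ?(ltnW (ltn_ord i)) // big_ord_recr.
Qed.

End Convolution.

Section Norms.
Context {R : realType}.
Implicit Types (c d : nat -> R) (a r lam mu : R).

Lemma sum_conv_le (K : numDomainType) (c d : nat -> K) n :
  (forall k, 0 <= c k) -> (forall k, 0 <= d k) ->
  \sum_(k < n) conv c d k <= (\sum_(i < n) c i) * (\sum_(j < n) d j).
Proof.
move=> c0 d0; rewrite sum_conv mulr_suml; apply: ler_sum => i _.
rewrite -mulr_sumr ler_wpM2l // -[in leRHS](subnK (ltnW (ltn_ord i))) big_split_ord /=.
by rewrite lerDl sumr_ge0.
Qed.

(** A bound on a weighted l1-norm. The norm is submultiplicative for the product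
    of power series, which is why bounds are sought in this form. *)
Definition majorized r c (B : R) := forall n, \sum_(k < n) `|c k| * r ^+ k <= B.

Lemma majorized_conv r c d B1 B2 : 0 <= r ->
  majorized r c B1 -> majorized r d B2 -> majorized r (conv c d) (B1 * B2).
Proof.
move=> r0 hc hd n.
apply: le_trans (_ : \sum_(k < n) conv (fun k => `|c k| * r ^+ k) (fun k => `|d k| * r ^+ k) k <= _).
  apply: ler_sum => k _; rewrite /conv.
  apply: le_trans (_ : (\sum_(i < k.+1) `|c i * d (k - i)%N|) * r ^+ k <= _).
    by rewrite ler_wpM2r ?exprn_ge0 // ler_norm_sum.
  rewrite mulr_suml; apply: ler_sum => i _; rewrite normrM mulrACA -exprD subnKC //.
  by rewrite -ltnS.
apply: le_trans (sum_conv_le _ _ _ _ _ _) _; try by move=> k; rewrite mulr_ge0 ?exprn_ge0.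
by apply: ler_pM => //; apply: sumr_ge0 => k _; rewrite mulr_ge0 ?exprn_ge0.
Qed.

Lemma conv_exp_term (K : numFieldType) (a b : K) : conv (exp_term a) (exp_term b) =1 exp_term (a + b).
Proof.
move=> k; rewrite /conv /exp_term addrC exprDn mulr_suml; apply: eq_bigr => i _.
have ik : (i <= k)%N by rewrite -ltnS.
have := bin_fact ik => /(congr1 (fun m => m%:R : K)); rewrite !natrM => <-.
have f0 m : m`!%:R != 0 :> K by rewrite pnatr_eq0 -lt0n fact_gt0.
rewrite -mulr_natr; field.
by rewrite !f0 pnatr_eq0 -lt0n bin_gt0 ik.
Qed.

Lemma conv_mul_linear a c d : conv c (mul_linear a d) =1 mul_linear a (conv c d).
Proof.
move=> k; rewrite /mul_linear /conv; case: k => [|k].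
  by rewrite !big_ord1 !addr0.
rewrite big_ord_recr /= subnn addr0 [in RHS]big_ord_recr /= subnn.
rewrite mulr_sumr addrAC -big_split /=; congr (_ + _).
apply: eq_bigr => i _; rewrite subSn ?(ltnW (ltn_ord i)) //; last by rewrite -ltnS.
by ring.
Qed.

Lemma mul_linear_conv a c d : conv (mul_linear a c) d =1 mul_linear a (conv c d).
Proof.
move=> k; rewrite /mul_linear /conv; case: k => [|k].
  by rewrite !big_ord1 !addr0.
rewrite big_ord_recl /= addr0 [in RHS]big_ord_recl /= mulr_sumr -addrA -big_split /=.
by congr (_ + _); apply: eq_bigr => i _; rewrite /bump /= add1n subSS; ring.
Qed.

Lemma eq_mul_linear a c1 c2 : c1 =1 c2 -> mul_linear a c1 =1 mul_linear a c2.
Proof. by move=> e [|k]; rewrite /mul_linear !e. Qed.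

Lemma prod_exp_coef_conv j lam mu :
  prod_exp_coef j (lam + mu) =1 conv (prod_exp_coef j lam) (exp_term mu).
Proof.
elim: j => [|j IH] k; first by rewrite /= conv_exp_term.
by rewrite /= mul_linear_conv; apply: eq_mul_linear.
Qed.

(** The Weierstrass factor [(1 + x/(j+1)) exp(- x/(j+1))], whose linear
    coefficient vanishes: its norm is [1 + O(1/j^2)]. *)
Definition weierstrass_factor (j : nat) : nat -> R :=
  @mul_linear R j.+1%:R^-1 (@exp_term R (- j.+1%:R^-1)).

Lemma prod_exp_coefS_conv j lam :
  prod_exp_coef j.+1 lam =1 conv (prod_exp_coef j (lam + j.+1%:R^-1)) (weierstrass_factor j).
Proof.
move=> k; rewrite conv_mul_linear /=; apply: eq_mul_linear => i.
by rewrite -prod_exp_coef_conv addrK.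
Qed.

Lemma exp_term_sum_le r n : 0 <= r -> \sum_(k < n) exp_term r k <= expR r.
Proof.
move=> r0; have nd : nondecreasing_seq (series (exp_coeff r)).
  by apply/nondecreasing_seqP => m; rewrite seriesSr lerDl /exp_coeff /= divr_ge0 ?exprn_ge0.
have := nondecreasing_cvgn_le nd (is_cvg_series_exp_coeff r) n.
by rewrite /series /= big_mkord.
Qed.

Lemma majorized_exp_term r a : 0 <= r -> majorized r (exp_term a) (expR (`|a| * r)).
Proof.
move=> r0 n; apply: le_trans (exp_term_sum_le _ n _); last by rewrite mulr_ge0.
by apply: ler_sum => k _; rewrite /exp_term normrM normrX normfV normr_nat exprMn mulrAC.
Qed.

Lemma weierstrass_factorSS j k : weierstrass_factor j k.+2 =
  (- 1) ^+ k.+1 * k.+1%:R / k.+2`!%:R * j.+1%:R^-1 ^+ k.+2.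
Proof.
rewrite /weierstrass_factor /mul_linear /exp_term.
have -> : (- j.+1%:R^-1 : R) = (-1) * j.+1%:R^-1 by rewrite mulN1r.
rewrite !exprMn !exprS !factS !natrM -[k.+2%:R]natr1.
have : k`!%:R != 0 :> R by rewrite pnatr_eq0 -lt0n fact_gt0.
have : k.+1%:R != 0 :> R by rewrite pnatr_eq0.
have : k.+1%:R + 1 != 0 :> R by rewrite natr1 pnatr_eq0.
move: (k.+1%:R : R) (k`!%:R : R) => m f h1 h2 h3.
by field; rewrite h1 h2 h3 /= addrC natr1 pnatr_eq0.
Qed.

Lemma majorized_weierstrass_factor r j : 0 <= r ->
  majorized r (weierstrass_factor j) (1 + expR r * (r / j.+1%:R) ^+ 2).
Proof.
move=> r0; set t := r / j.+1%:R.
have t0 : 0 <= t by rewrite divr_ge0.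
have tr : t <= r by rewrite ler_pdivrMr ?ltr0n // ler_peMr // ler1n.
have w0 : weierstrass_factor j 0 = 1 by rewrite /weierstrass_factor /mul_linear /exp_term fact0 addr0 divr1.
have w1 : weierstrass_factor j 1 = 0 by rewrite /weierstrass_factor /mul_linear /exp_term fact0 expr1 expr0 !divr1 mulr1 addNr.
have bnd n : \sum_(k < n.+2) `|weierstrass_factor j k| * r ^+ k <= 1 + expR r * t ^+ 2.
  rewrite !big_ord_recl /= w0 w1 normr1 normr0 expr0 mul0r add0r mulr1 lerD2l.
  apply: le_trans (_ : (\sum_(k < n) exp_term r k) * t ^+ 2 <= _); last first.
    by rewrite ler_wpM2r ?exprn_ge0 // exp_term_sum_le.
  rewrite mulr_suml; apply: ler_sum => i _; rewrite /bump /= !add1n weierstrass_factorSS.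
  have -> : `|(-1) ^+ i.+1 * i.+1%:R / i.+2`!%:R * j.+1%:R^-1 ^+ i.+2| * r ^+ i.+2 =
      i.+1%:R / i.+2`!%:R * t ^+ i * t ^+ 2.
    rewrite -[RHS]mulrA -exprD addn2; move: (i.+2) => e; move: (i.+1) => m.
    rewrite -!mulrA normrMsign ger0_norm.
      by rewrite /t exprMn !mulrA mulrAC.
    by rewrite !mulr_ge0 ?invr_ge0 ?exprn_ge0 ?invr_ge0.
  rewrite /exp_term ler_wpM2r ?exprn_ge0 //.
  rewrite mulrC; apply: ler_pM; rewrite ?exprn_ge0 ?divr_ge0 //; first by rewrite lerXn2r ?nnegrE.
  rewrite ler_pdivrMr ?ltr0n ?fact_gt0 // !factS mulnA natrM.
  rewrite mulrC mulfK ?pnatr_eq0 -?lt0n ?fact_gt0 // ler_nat; lia.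
have P0 : 0 <= expR r * t ^+ 2 by rewrite mulr_ge0 ?expR_ge0 ?exprn_ge0.
case=> [|[|n]]; last exact: bnd.
  by rewrite big_ord0 addr_ge0.
by rewrite big_ord1 w0 normr1 expr0 mulr1 lerDl.
Qed.

Lemma sum_invsq_le n : \sum_(j < n) (j.+1%:R ^- 2 : R) <= 2.
Proof.
suff : \sum_(j < n.+1) (j.+1%:R ^- 2 : R) <= 2 - n.+1%:R^-1.
  rewrite big_ord_recr /= => h; apply: le_trans (_ : _ <= 2 - n.+1%:R^-1) _.
    by apply: le_trans h; rewrite lerDl invr_ge0 exprn_ge0.
  by rewrite gerBl invr_ge0.
elim: n => [|n IH]; first by rewrite big_ord1 expr1n invr1; lra.
rewrite big_ord_recr /=; apply: le_trans (lerD IH (lexx _)) _.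
rewrite -[n.+2%:R]natr1; have : 1 <= n.+1%:R :> R by rewrite ler1n.
move: (n.+1%:R : R) => m m1; rewrite -subr_ge0.
rewrite (_ : _ - _ = (m * (m + 1) ^+ 2)^-1); last by field; lra.
by rewrite invr_ge0; nra.
Qed.

(** The Gauss product is regrouped into Weierstrass factors, so that the bound
    only involves [sum 1/i^2] and [lam + H_j]. *)
Lemma majorized_prod_exp_coef r j lam : 0 <= r ->
  majorized r (prod_exp_coef j lam)
    (expR (\sum_(i < j) expR r * r ^+ 2 * i.+1%:R ^- 2) *
     expR (`|lam + \sum_(i < j) i.+1%:R^-1| * r)).
Proof.
move=> r0; elim: j lam => [|j IH] lam.
  by rewrite !big_ord0 expR0 mul1r addr0; exact: majorized_exp_term.
move=> n; under eq_bigr do rewrite prod_exp_coefS_conv.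
apply: le_trans (majorized_conv _ _ _ _ _ r0 (IH _) (majorized_weierstrass_factor _ _ r0) n) _.
rewrite !big_ord_recr /= expRD -[lam + _ + _]addrA [j.+1%:R^-1 + _]addrC.
rewrite mulrAC; apply: ler_wpM2r; first exact: expR_ge0.
apply: ler_wpM2l; first exact: expR_ge0.
by rewrite exprMn exprVn mulrA; exact: expR_ge1Dx.
Qed.

(** The inequalities [1/(m+1) <= ln (m+1) - ln m <= 1/m], summed over [m]. *)
Lemma harmonic_ln_itv N :
  0 <= ln (N.+2%:R^-1 : R) + \sum_(i < N.+1) i.+1%:R^-1 <= 1.
Proof.
have step (m : R) : 0 < m ->
    0 <= m^-1 + ln m - ln (m + 1) /\ (m + 1)^-1 + ln m - ln (m + 1) <= 0.
  move=> m0; have m1 : 0 < m + 1 by rewrite addr_gt0.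
  have e1 : ln (m + 1) - ln m = ln (1 + m^-1).
    by rewrite -ln_div ?posrE // mulrDl mulfV ?gt_eqF // mul1r.
  have h1 : ln (1 + m^-1) <= m^-1.
    by apply: le_ln1Dx; rewrite (lt_trans (_ : _ < 0)) ?invr_gt0 // oppr_lt0.
  have e2 : ln m - ln (m + 1) = ln (1 - (m + 1)^-1).
    rewrite -ln_div ?posrE //; congr ln; field; exact: lt0r_neq0.
  have h2 : ln (1 - (m + 1)^-1) <= - (m + 1)^-1.
    by apply: le_ln1Dx; rewrite ltrN2 invf_lt1 // ltrDr.
  by split; lra.
(* the upper bound is strengthened so that the induction goes through *)
suff h : 0 <= ln (N.+2%:R^-1 : R) + \sum_(i < N.+1) i.+1%:R^-1 <= 1 - N.+2%:R^-1.
  by case/andP: h => a b; rewrite a (le_trans b) // gerBl invr_ge0.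
rewrite lnV ?posrE ?ltr0n //; elim: N => [|N /andP[IH1 IH2]].
  rewrite big_ord1 invr1; have [h1 h2] := step 1 ltr01.
  move: h1 h2; rewrite ln1 invr1 (_ : 1 + 1 = 2%:R) //.
  by move: (2%:R^-1) (ln _) => u v; lra.
rewrite big_ord_recr /=; have [h1 h2] := step N.+2%:R (ltr0Sn _ _).
move: IH1 IH2 h1 h2; rewrite natr1.
move: (ln N.+2%:R) (ln N.+3%:R) (N.+2%:R^-1) (N.+3%:R^-1) (\sum_(i < N.+1) _).
by move=> a b c d e; lra.
Qed.

Lemma majorized_gauss_coef r : 0 <= r ->
  exists B, forall N, majorized r (gauss_coef N) B.
Proof.
move=> r0; exists (expR (expR r * r ^+ 2 * 2) * expR r) => N n.
apply: le_trans (majorized_prod_exp_coef _ _ _ r0 n) _.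
apply: ler_pM; rewrite ?expR_ge0 // ler_expR.
  rewrite -mulr_sumr ler_wpM2l ?mulr_ge0 ?expR_ge0 ?exprn_ge0 //.
  exact: sum_invsq_le.
have /andP[h1 h2] := harmonic_ln_itv N.
by rewrite ger0_norm // ler_piMl.
Qed.

End Norms.

(** * Limits of complex sequences *)

Section ComplexLimits.
Context {R : realType}.
Local Notation C := R[i].
Local Notation Re := complex.Re.
Local Notation Im := complex.Im.

Lemma normCE (z : C) : `|z| = (normc z)%:C. Proof. by []. Qed.

Lemma normc_ge0 (z : C) : 0 <= normc z.
Proof. by rewrite -ler0c -normCE. Qed.

Lemma normc_real (x : R) : normc x%:C = `|x|.
Proof. by rewrite /normc /= expr0n addr0 sqrtr_sqr. Qed.

Lemma normr_Re_le (z : C) : `|Re z| <= normc z.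
Proof. by rewrite -lecR; exact: normc_ge_Re. Qed.

Lemma normr_Im_le (z : C) : `|Im z| <= normc z.
Proof. by case: z => a b; rewrite /= -sqrtr_sqr ler_wsqrtr // lerDr sqr_ge0. Qed.

Lemma normc_le_ReIm (z : C) : normc z <= `|Re z| + `|Im z|.
Proof.
case: z => a b /=; rewrite -[leRHS]ger0_norm ?addr_ge0 // -sqrtr_sqr ler_wsqrtr //.
rewrite sqrrD !real_normK ?num_real // [leRHS]addrAC lerDl.
by rewrite mulrn_wge0 // mulr_ge0.
Qed.

Lemma normcX (z : C) n : normc (z ^+ n) = normc z ^+ n.
Proof. by elim: n => [|n IH]; rewrite ?normc1 // !exprS normcM IH. Qed.

Lemma ReD (x y : C) : Re (x + y) = Re x + Re y. Proof. by case: x y => ? ? []. Qed.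
Lemma ImD (x y : C) : Im (x + y) = Im x + Im y. Proof. by case: x y => ? ? []. Qed.
Lemma ReB (x y : C) : Re (x - y) = Re x - Re y. Proof. by case: x y => ? ? []. Qed.
Lemma ImB (x y : C) : Im (x - y) = Im x - Im y. Proof. by case: x y => ? ? []. Qed.

Lemma Re_sum n (u : 'I_n -> C) : Re (\sum_(k < n) u k) = \sum_(k < n) Re (u k).
Proof. exact: (big_morph _ ReD). Qed.

Lemma Im_sum n (u : 'I_n -> C) : Im (\sum_(k < n) u k) = \sum_(k < n) Im (u k).
Proof. exact: (big_morph _ ImD). Qed.

Lemma Re_scale (a : R) (z : C) : Re (a%:C * z) = a * Re z.
Proof. by case: z => u v /=; rewrite mul0r subr0. Qed.

Lemma Im_scale (a : R) (z : C) : Im (a%:C * z) = a * Im z.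
Proof. by case: z => u v /=; rewrite mul0r addr0. Qed.

Lemma cvgC_dist (u : nat -> C) (l : C) (v : nat -> R) :
  (forall n, normc (l - u n) <= v n) -> v @ \oo --> 0 -> u @ \oo --> (l : C^o).
Proof.
move=> uv v0; apply/(@cvgrPdist_le _ C^o) => /= e; rewrite ltcE => /andP[/eqP /= e2 e1].
have /cvgrPdist_le/(_ _ e1)[M _ HM] := v0.
exists M => // n Mn; rewrite /= normCE lecE e2 eqxx /=.
by apply: le_trans (uv n) _; have := HM n Mn; rewrite sub0r normrN => /(le_trans (ler_norm _)).
Qed.

Lemma cvgC_ReIm (u : nat -> C) (l : C) :
  (fun n => Re (u n)) @ \oo --> Re l -> (fun n => Im (u n)) @ \oo --> Im l ->
  u @ \oo --> (l : C^o).
Proof.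
move=> hR hI; apply: (cvgC_dist _ _ (fun n => `|Re l - Re (u n)| + `|Im l - Im (u n)|)).
  by move=> n; rewrite -ReB -ImB; exact: normc_le_ReIm.
have h (w : nat -> R) (a : R) : w @ \oo --> a -> (fun n => `|a - w n|) @ \oo --> 0.
  move=> wa; rewrite -(normr0 R) -(subrr a); apply: cvg_norm.
  by apply: cvgB => //; exact: cvg_cst.
by rewrite -[X in _ --> X]addr0; apply: cvgD; exact: h.
Qed.

Lemma cvgC_normc (u : nat -> C) (l : C) :
  u @ \oo --> (l : C^o) -> (fun n => normc (l - u n)) @ \oo --> 0.
Proof.
move=> ul; apply/cvgrPdist_le => /= e e0.
have /(@cvgrPdist_le _ C^o)/(_ e%:C) := ul; rewrite ltcR => /(_ e0)[M _ HM].
exists M => // n Mn /=; rewrite sub0r normrN ger0_norm ?normc_ge0 //.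
by rewrite -lecR -normCE; exact: (HM n Mn).
Qed.

Lemma cvgC_Re (u : nat -> C) (l : C) :
  u @ \oo --> (l : C^o) -> (fun n => Re (u n)) @ \oo --> Re l.
Proof.
move=> /cvgC_normc/cvgrPdist_le h; apply/cvgrPdist_le => /= e /h[M _ HM].
exists M => // n /HM /=; rewrite sub0r normrN ger0_norm ?normc_ge0 //.
by rewrite -ReB; apply: le_trans; exact: normr_Re_le.
Qed.

Lemma cvgC_Im (u : nat -> C) (l : C) :
  u @ \oo --> (l : C^o) -> (fun n => Im (u n)) @ \oo --> Im l.
Proof.
move=> /cvgC_normc/cvgrPdist_le h; apply/cvgrPdist_le => /= e /h[M _ HM].
exists M => // n /HM /=; rewrite sub0r normrN ger0_norm ?normc_ge0 //.
by rewrite -ImB; apply: le_trans; exact: normr_Im_le.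
Qed.

Lemma cvgC_unique (u : nat -> C) (l1 l2 : C) :
  u @ \oo --> (l1 : C^o) -> u @ \oo --> (l2 : C^o) -> l1 = l2.
Proof.
move=> h1 h2; apply/eqP; rewrite eq_complex; apply/andP; split; apply/eqP.
  exact: (cvg_unique _ (cvgC_Re _ _ h1) (cvgC_Re _ _ h2)).
exact: (cvg_unique _ (cvgC_Im _ _ h1) (cvgC_Im _ _ h2)).
Qed.

Lemma cvgC_real (u : nat -> R) (l : R) :
  u @ \oo --> l -> (fun n => (u n)%:C) @ \oo --> (l%:C : C^o).
Proof. by move=> ul; apply: cvgC_ReIm => //=; exact: cvg_cst. Qed.

Lemma cvgCD (u v : nat -> C) (a b : C) :
  u @ \oo --> (a : C^o) -> v @ \oo --> (b : C^o) ->
  (fun n => u n + v n) @ \oo --> (a + b : C^o).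
Proof.
move=> ua vb; apply: cvgC_ReIm.
  by rewrite ReD; under eq_cvg do rewrite ReD; apply: cvgD; exact: cvgC_Re.
by rewrite ImD; under eq_cvg do rewrite ImD; apply: cvgD; exact: cvgC_Im.
Qed.

Lemma ReM (x y : C) : Re (x * y) = Re x * Re y - Im x * Im y.
Proof. by case: x y => ? ? []. Qed.
Lemma ImM (x y : C) : Im (x * y) = Re x * Im y + Im x * Re y.
Proof. by case: x y => ? ? []. Qed.

Lemma cvgCM (u v : nat -> C) (a b : C) :
  u @ \oo --> (a : C^o) -> v @ \oo --> (b : C^o) ->
  (fun n => u n * v n) @ \oo --> (a * b : C^o).
Proof.
move=> ua vb; have [uR uI] := (cvgC_Re _ _ ua, cvgC_Im _ _ ua).
have [vR vI] := (cvgC_Re _ _ vb, cvgC_Im _ _ vb).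
apply: cvgC_ReIm.
  by rewrite ReM; under eq_cvg do rewrite ReM; apply: cvgB; apply: cvgM.
by rewrite ImM; under eq_cvg do rewrite ImM; apply: cvgD; apply: cvgM.
Qed.

Lemma cvgC_eq (u v : nat -> C) (l : C) : u =1 v ->
  u @ \oo --> (l : C^o) -> v @ \oo --> (l : C^o).
Proof. by move=> /funext ->. Qed.

Lemma cvgC_cst (l : C) : (fun=> l) @ \oo --> (l : C^o).
Proof. by apply: cvgC_ReIm; exact: cvg_cst. Qed.

Lemma cvgC_shiftS (u : nat -> C) (l : C) :
  (fun n => u n.+1) @ \oo --> (l : C^o) <-> u @ \oo --> (l : C^o).
Proof.
split=> ul; apply: cvgC_ReIm.
- by rewrite -cvg_shiftS; exact: (cvgC_Re _ _ ul).
- by rewrite -cvg_shiftS; exact: (cvgC_Im _ _ ul).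
- by rewrite (cvg_shiftS (fun n => Re (u n))); exact: cvgC_Re.
- by rewrite (cvg_shiftS (fun n => Im (u n))); exact: cvgC_Im.
Qed.

End ComplexLimits.

(** * The complex exponential series *)

Section ComplexExponential.
Context {R : realType}.
Local Notation C := R[i].
Local Notation Re := complex.Re.
Local Notation Im := complex.Im.

Definition cexp (z : C) : C := expR (Re z) * cos (Im z) +i* (expR (Re z) * sin (Im z)).

Lemma exp_term_imaginary (b : R) k : exp_term (0 +i* b : C) k = cos_coeff b k +i* sin_coeff b k.
Proof.
have f0 : k`!%:R != 0 :> C by rewrite pnatr_eq0 -lt0n fact_gt0.
apply: (mulIf f0); rewrite /exp_term divfK //.
have -> : k`!%:R = (k`!%:R : R)%:C by rewrite rmorph_nat.
have -> : (0 +i* b : C) = 'i * b%:C by apply/eqP; rewrite eq_complex /=; simpc; rewrite ?eqxx.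
rewrite exprMn -[in 'i ^+ k](odd_double_half k) exprD -mul2n exprM sqr_i.
rewrite -rmorphXn /=.
have -> : (-1) ^+ k./2 = ((-1) ^+ k./2 : R)%:C by rewrite rmorphXn rmorphN rmorph1.
have fk : k`!%:R != 0 :> R by rewrite pnatr_eq0 -lt0n fact_gt0.
rewrite /cos_coeff /sin_coeff /=.
case ok: (odd k); rewrite /= ?expr1 ?expr0 ?mul1r ?mul0r.
  have kh : k.-1./2 = k./2.
    by rewrite -[in LHS](odd_double_half k) ok add1n /= doubleK.
  rewrite kh; apply/eqP; rewrite eq_complex /=; simpc.
  by rewrite divfK // eqxx.
apply/eqP; rewrite eq_complex /=; simpc.
by rewrite divfK // eqxx.
Qed.

(** The defect between a product of partial sums and the partial sum of the
    Cauchy product consists of the terms [c i * d j] with [i + j >= n]. *)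
Lemma norm_sum_conv_le (K : numDomainType) (c d : nat -> K) n :
  `|(\sum_(i < n) c i) * (\sum_(j < n) d j) - \sum_(k < n) conv c d k| <=
  (\sum_(i < n) `|c i|) * (\sum_(j < n) `|d j|)
    - \sum_(k < n) conv (fun i => `|c i|) (fun j => `|d j|) k.
Proof.
have E (c' d' : nat -> K) : (\sum_(i < n) c' i) * (\sum_(j < n) d' j) - \sum_(k < n) conv c' d' k =
    \sum_(i < n) c' i * (\sum_(j < i) d' (n - i + j)%N).
  rewrite sum_conv mulr_suml -sumrB; apply: eq_bigr => i _.
  rewrite -mulr_sumr -mulrBr; congr (_ * _).
  rewrite -[in X in X - _](subnK (ltnW (ltn_ord i))) big_split_ord /=.
  by rewrite addrAC subrr add0r.
rewrite !E; apply: le_trans (ler_norm_sum _ _ _) _; apply: ler_sum => i _.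
by rewrite normrM ler_wpM2l // ler_norm_sum.
Qed.

Lemma norm_sum_exp_term_mul (K : numFieldType) (x y : K) n :
  `|(\sum_(k < n) exp_term x k) * (\sum_(k < n) exp_term y k) - \sum_(k < n) exp_term (x + y) k| <=
  (\sum_(k < n) exp_term `|x| k) * (\sum_(k < n) exp_term `|y| k) - \sum_(k < n) exp_term (`|x| + `|y|) k.
Proof.
have normE (z : K) k : `|exp_term z k| = exp_term `|z| k.
  by rewrite /exp_term normrM normfV normr_nat normrX.
have sumE (z w : K) : \sum_(k < n) exp_term (z + w) k = \sum_(k < n) conv (exp_term z) (exp_term w) k.
  by apply: eq_bigr => k _; rewrite conv_exp_term.
rewrite !sumE; apply: le_trans (norm_sum_conv_le _ _ _ _) _.
rewrite le_eqVlt; apply/orP; left; apply/eqP; congr (_ * _ - _).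
- by apply: eq_bigr => k _; rewrite normE.
- by apply: eq_bigr => k _; rewrite normE.
- by apply: eq_bigr => k _; apply: eq_bigr => i _; rewrite !normE.
Qed.

Lemma sum_exp_term_morph (K : numFieldType) (f : {rmorphism R -> K}) (a : R) n :
  \sum_(k < n) exp_term (f a) k = f (\sum_(k < n) exp_term a k).
Proof.
rewrite rmorph_sum; apply: eq_bigr => k _.
by rewrite /exp_term rmorphM fmorphV rmorph_nat rmorphXn.
Qed.

(** The defect in [exp (x + y) = exp x exp y] is controlled by the one for the
    moduli, which is real. *)
Lemma norm_sum_exp_term_morph (K : numFieldType) (f : {rmorphism R -> K}) (x y : K) (a b : R) n :
  `|x| = f a -> `|y| = f b ->
  `|\sum_(k < n) exp_term (x + y) k - (\sum_(k < n) exp_term x k) * (\sum_(k < n) exp_term y k)| <=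
  f ((\sum_(k < n) exp_term a k) * (\sum_(k < n) exp_term b k) - \sum_(k < n) exp_term (a + b) k).
Proof.
move=> xa yb; rewrite distrC; apply: le_trans (norm_sum_exp_term_mul _ _ _ _) _.
by rewrite xa yb -rmorphD !sum_exp_term_morph -rmorphM -rmorphB.
Qed.

Lemma cvg_exp_term_real (a : R) : (fun n => \sum_(k < n) exp_term a k) @ \oo --> expR a.
Proof.
have := is_cvg_series_exp_coeff a; rewrite /expR => h.
by under eq_cvg do rewrite -(big_mkord xpredT (exp_term a)).
Qed.

Lemma cvg_exp_term_realC (a : R) :
  (fun n => \sum_(k < n) exp_term (a%:C : C) k) @ \oo --> ((expR a)%:C : C^o).
Proof.
apply: (cvgC_eq _ _ _ (fun n => esym (sum_exp_term_morph _ (real_complex R) a n))).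
by apply: cvgC_real; exact: cvg_exp_term_real.
Qed.

Lemma cvg_exp_term_imaginary (b : R) :
  (fun n => \sum_(k < n) exp_term (0 +i* b : C) k) @ \oo --> (cos b +i* sin b : C^o).
Proof.
apply: cvgC_ReIm.
  under eq_cvg do rewrite Re_sum.
  have := @is_cvg_series_cos_coeff R b; rewrite cos.unlock.
  apply: cvg_trans; apply: near_eq_cvg; apply: nearW => n.
  by rewrite /series /= big_mkord; apply: eq_bigr => k _; rewrite exp_term_imaginary.
under eq_cvg do rewrite Im_sum.
have := @is_cvg_series_sin_coeff R b; rewrite sin.unlock.
apply: cvg_trans; apply: near_eq_cvg; apply: nearW => n.
by rewrite /series /= big_mkord; apply: eq_bigr => k _; rewrite exp_term_imaginary.
Qed.

(** The series of [exp a] and [exp (i b)] are multiplied; the defect is bounded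
    by the one for [exp |a| exp |b|], a real quantity that tends to 0. *)
Lemma cvg_exp_term (z : C) : (fun n => \sum_(k < n) exp_term z k) @ \oo --> (cexp z : C^o).
Proof.
case: z => a b; pose v n : R := (\sum_(k < n) exp_term `|a| k) * (\sum_(k < n) exp_term `|b| k)
  - \sum_(k < n) exp_term (`|a| + `|b|) k.
have v0 : v @ \oo --> 0.
  rewrite -(subrr (expR (`|a| + `|b|))); apply: cvgB; last exact: cvg_exp_term_real.
  by rewrite expRD; apply: cvgM; exact: cvg_exp_term_real.
pose P n : C := (\sum_(k < n) exp_term (a%:C : C) k) * (\sum_(k < n) exp_term (0 +i* b : C) k).
pose S n : C := \sum_(k < n) exp_term (a%:C + (0 +i* b) : C) k.
have bnd n : normc (0 - (S n - P n)) <= v n.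
  rewrite sub0r normcN -lecR -normCE.
  apply: (norm_sum_exp_term_morph _ (real_complex R)); rewrite normCE.
    by rewrite normc_real.
  by rewrite /= expr0n add0r sqrtr_sqr.
have e1 := cvgC_dist _ _ _ bnd v0.
have cP : P @ \oo --> ((expR a)%:C * (cos b +i* sin b) : C^o).
  by apply: cvgCM; [exact: cvg_exp_term_realC|exact: cvg_exp_term_imaginary].
have := cvgCD _ _ _ _ cP e1; rewrite addr0.
have -> : (expR a)%:C * (cos b +i* sin b) = cexp (a +i* b).
  by rewrite /cexp /= /GRing.mul /= !mul0r subr0 addr0.
have -> : (fun n => \sum_(k < n) exp_term (a +i* b) k) = S.
  by apply/funext => n; congr (\sum_(k < n) exp_term _ k); rewrite /GRing.add /= addr0 add0r.
by apply: cvgC_eq => n; rewrite addrC subrK.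
Qed.

End ComplexExponential.

(** * Gauss products as power series *)

Section PowerSeries.
Context {R : realType}.
Local Notation C := R[i].
Local Notation Re := complex.Re.
Local Notation Im := complex.Im.

Lemma cvg_mul_linear (a : R) (c : nat -> R) (x l : C) :
  series (fun k => (c k)%:C * x ^+ k) @ \oo --> (l : C^o) ->
  series (fun k => (mul_linear a c k)%:C * x ^+ k) @ \oo --> ((1 + a%:C * x) * l : C^o).
Proof.
move=> cl; apply/cvgC_shiftS.
have E n : series (fun k => (mul_linear a c k)%:C * x ^+ k) n.+1 =
    series (fun k => (c k)%:C * x ^+ k) n.+1 + a%:C * x * series (fun k => (c k)%:C * x ^+ k) n.
  elim: n => [|n IH].
    by rewrite /series /= !big_nat1 big_geq // mulr0 addr0 /mul_linear addr0.
  rewrite seriesSr IH [in RHS]seriesSr [series _ n.+1 in X in _ = _ + X]seriesSr.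
  by rewrite [mul_linear _ _ _]/mul_linear rmorphD rmorphM /= exprS; ring.
apply: (cvgC_eq _ _ _ (fun n => esym (E n))).
rewrite mulrDl mul1r; apply: cvgCD; first exact/(cvgC_shiftS (series _)).
exact: cvgCM (cvgC_cst _) cl.
Qed.

Lemma cvg_prod_exp_coef j (lam : R) (x : C) :
  series (fun k => (prod_exp_coef j lam k)%:C * x ^+ k) @ \oo -->
    ((\prod_(i < j) (1 + x / i.+1%:R)) * cexp (lam%:C * x) : C^o).
Proof.
elim: j => [|j IH].
  rewrite big_ord0 mul1r; have := cvg_exp_term (lam%:C * x).
  apply: cvgC_eq => n; rewrite /series /= big_mkord; apply: eq_bigr => k _.
  by rewrite /exp_term exprMn rmorphM fmorphV rmorph_nat rmorphXn /= mulrAC.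
have := cvg_mul_linear j.+1%:R^-1 _ _ _ IH.
by rewrite big_ord_recr /= fmorphV rmorph_nat [x / _]mulrC mulrCA mulrA.
Qed.

(** The majorant at radius [2 |x| + 1] dominates the series at [x] by a
    geometric series of ratio [1/2]. *)
Lemma power_series_cvg (e : nat -> nat -> R) (a : nat -> R) (E : nat -> C) (x : C) (B : R) :
  (forall k, e ^~ k @ \oo --> a k) ->
  (forall N, majorized (2 * normc x + 1) (e N) B) ->
  (forall N, series (fun k => (e N k)%:C * x ^+ k) @ \oo --> (E N : C^o)) ->
  exists l : C, series (fun k => (a k)%:C * x ^+ k) @ \oo --> (l : C^o) /\ E @ \oo --> (l : C^o).
Proof.
move=> ea eB eE; set r := normc x in eB; have r0 : 0 <= r := normc_ge0 x.
pose g k : R := B * 2^-1 ^+ k.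
have B0 : 0 <= B by have := eB 0 0; rewrite big_ord0.
have gc : cvgn (series g).
  by apply: is_cvg_geometric_series; rewrite ger0_norm ?invr_ge0 // invf_lt1 // ltr1n.
have bnd (z : R) k N : `|z| <= r ^+ k -> `|e N k * z| <= g k.
  move=> zr; rewrite normrM.
  apply: le_trans (_ : `|e N k| * r ^+ k <= _); first exact: ler_wpM2l.
  rewrite /g exprVn ler_pdivlMr ?exprn_gt0 // -mulrA -exprMn.
  apply: le_trans (_ : `|e N k| * (2 * r + 1) ^+ k <= _).
    by rewrite ler_wpM2l // lerXn2r ?nnegrE ?mulr_ge0 ?addr_ge0 ?mulr_ge0 //; lra.
  apply: le_trans (eB N k.+1); rewrite big_ord_recr /= lerDr sumr_ge0 // => i _.
  by rewrite mulr_ge0 // exprn_ge0 //; lra.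
have part (phi : C -> R) :
    (forall b z, phi (b%:C * z) = b * phi z) ->
    (forall n (u : 'I_n -> C), phi (\sum_(k < n) u k) = \sum_(k < n) phi (u k)) ->
    (forall z, `|phi z| <= normc z) ->
    (forall u l, u @ \oo --> (l : C^o) -> (fun n => phi (u n)) @ \oo --> phi l) ->
  exists l : R, (fun n => phi (series (fun k => (a k)%:C * x ^+ k) n)) @ \oo --> l /\
    (fun N => phi (E N)) @ \oo --> l.
  move=> phiZ phi_sum phi_le phi_cvg.
  have phi_series (c : nat -> R) n : phi (series (fun k => (c k)%:C * x ^+ k) n) =
      series (fun k => c k * phi (x ^+ k)) n.
    by rewrite /series /= !big_mkord phi_sum; apply: eq_bigr => k _; rewrite phiZ.
  have fg N k : `|e N k * phi (x ^+ k)| <= g k by apply: bnd; rewrite -normcX.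
  have fF k : e N k * phi (x ^+ k) @[N --> \oo] --> a k * phi (x ^+ k).
    by apply: cvgM; [exact: ea|exact: cvg_cst].
  have fs N : series (fun k => e N k * phi (x ^+ k)) @ \oo --> phi (E N).
    by under eq_cvg do rewrite -phi_series; exact: phi_cvg.
  have [cF lF] := tannery _ _ _ _ fg gc fF fs.
  exists (limn (series (fun k => a k * phi (x ^+ k)))); split => //.
  by under eq_cvg do rewrite phi_series.
have [lR [aR ER]] := part _ Re_scale (@Re_sum R) normr_Re_le cvgC_Re.
have [lI [aI EI]] := part _ Im_scale (@Im_sum R) normr_Im_le cvgC_Im.
by exists (lR +i* lI); split; exact: cvgC_ReIm.
Qed.

(** Gauss's approximation of [1 / Gamma(x + 1)]. *)
Definition gauss_rgamma (N : nat) (x : C) : C :=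
  (\prod_(i < N.+1) (1 + x / i.+1%:R)) * cexp ((ln (N.+2%:R^-1 : R))%:C * x).

(** The common value is identified by [gauss_rgamma_cvg] below. *)
Lemma rgamma_series_cvg (x : C) : exists l : C,
  series (fun k => (rgamma_coef R k)%:C * x ^+ k) @ \oo --> (l : C^o) /\
  gauss_rgamma ^~ x @ \oo --> (l : C^o).
Proof.
have r0 : 0 <= 2 * normc x + 1 by have := normc_ge0 x; lra.
have [B HB] := majorized_gauss_coef _ r0.
apply: (power_series_cvg gauss_coef (rgamma_coef R) (gauss_rgamma ^~ x) x B) => //.
- by move=> k; have [] := @rgamma_coef_cvg R k.
- by move=> N; exact: cvg_prod_exp_coef.
Qed.

End PowerSeries.

(** * The sum of the inverse squares *)

Section Basel.
Context {R : realType}.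

(** By the mean value theorem [sin x] is [x cos c] with [0 < c < x], hence lies
    between [x cos x] and [x]. *)
Lemma sin_bounds (x : R) : 0 < x < pi / 2 ->
  sin x ^- 2 - 1 <= x ^- 2 <= sin x ^- 2.
Proof.
move=> /andP[x0 xpi]; have spos : 0 < sin x by apply: sin_gt0_pihalf; rewrite x0.
have pi0 := pi_gt0 R; have xlepi : x <= pi by lra.
have [c cI e] : exists2 c, c \in `]0, x[ & sin x - sin 0 = cos c * (x - 0).
  apply: (@MVT R sin cos) => //.
  by apply: derivable_within_continuous => y _; exact: ex_derive.
move: e cI; rewrite sin0 !subr0 in_itv /= => e /andP[c0 cx].
have cc : cos x <= cos c.
  by apply/ltW; rewrite ltr_cos // in_itv /=; apply/andP; split; lra.
have c1 : cos c <= 1 := cos_le1 c.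
have cx0 : 0 < cos x by apply: cos_gt0_pihalf; apply/andP; split; lra.
have x20 : 0 < x ^+ 2 by rewrite exprn_gt0.
have s20 : 0 < sin x ^+ 2 by rewrite exprn_gt0.
apply/andP; split; last first.
  rewrite lef_pV2 ?posrE // lerXn2r ?nnegrE ?(ltW spos) ?(ltW x0) //.
  by rewrite e ler_piMl // ltW.
have -> : sin x ^- 2 - 1 = cos x ^+ 2 / sin x ^+ 2.
  by rewrite cos2sin2 mulrBl mul1r divff // gt_eqF.
rewrite ler_pdivrMr // mulrC -ler_pdivrMr ?invr_gt0 // invrK -exprMn.
rewrite lerXn2r ?nnegrE ?(ltW spos) ?mulr_ge0 ?(ltW cx0) ?(ltW x0) //.
by rewrite e ler_wpM2r // ltW.
Qed.

(* The points [k pi / (2 M)] with [M = m + 1] and [0 < k < M], and the sum of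
   [1 / sin^2] over them. *)
Let ang (m i : nat) : R := i.+1%:R * pi / (2 * m.+1%:R).
Let T (m : nat) : R := \sum_(i < m) sin (ang m i) ^- 2.

Lemma sin_half_inv (x : R) : sin x != 0 -> cos x != 0 ->
  sin x ^- 2 + sin (pi / 2 - x) ^- 2 = 4 * sin (x *+ 2) ^- 2.
Proof.
move=> s0 c0; rewrite sin_mulr2n.
have -> : sin (pi / 2 - x) = cos x by rewrite -opprB sinN sinBpihalf opprK.
have e := cos2Dsin2 x.
transitivity ((cos x ^+ 2 + sin x ^+ 2) / (sin x ^+ 2 * cos x ^+ 2)).
  by field; rewrite s0 c0.
by rewrite e -mulr_natl; field; rewrite s0 c0.
Qed.

(* [1 / sin^2 x + 1 / cos^2 x = 4 / sin^2 (2 x)] pairs the points [k] and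
   [2 M - k]; the middle point [pi / 4] contributes 2. *)
Let T_double m : T (m + (1 + m)) = 4 * T m + 2.
Proof.
have pi0 := pi_gt0 R.
rewrite /T big_split_ord big_split_ord big_ord1 /=.
have N0 (n : nat) : (n.+1%:R : R) != 0 by rewrite pnatr_eq0.
have M0 : 0 < m.+1%:R :> R by rewrite ltr0n.
have nM : (m + (1 + m)).+1%:R = 2 * m.+1%:R :> R by rewrite -natrM; congr (_%:R); lia.
have -> : ang (m + (1 + m)) (m + 0) = pi / 4.
  rewrite /ang addn0 nM; field; exact: lt0r_neq0.
have -> : sin (pi / 4 : R) ^- 2 = 2.
  have s2 : sin (pi / 4 : R) ^+ 2 = 2^-1.
    have := cos_mulr2n (pi / 4 : R).
    have -> : (pi / 4 : R) *+ 2 = pi / 2 by rewrite -mulr_natl; field.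
    by rewrite cos_pihalf sin2cos2 -mulr_natl; lra.
  by rewrite s2 invrK.
rewrite [X in _ + (2 + X)](reindex_inj rev_ord_inj) /=.
rewrite addrCA addrC -big_split mulr_sumr; congr (_ + _); apply: eq_bigr => i _ /=.
have im : (i.+1 <= m)%N by [].
have -> : ang (m + (1 + m)) (m + (1 + (m - i.+1))) = pi / 2 - ang (m + (1 + m)) i.
  rewrite /ang nM.
  have -> : (m + (1 + (m - i.+1))).+1%:R = 2 * m.+1%:R - i.+1%:R :> R.
    by rewrite -natrM -natrB; [congr (_%:R); lia|lia].
  by field; exact: lt0r_neq0.
have hx : 0 < ang (m + (1 + m)) i < pi / 2.
  rewrite /ang nM; apply/andP; split; first by rewrite divr_gt0 ?mulr_gt0 ?ltr0n.
  rewrite ltr_pdivrMr ?mulr_gt0 //.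
  have -> : pi / 2 * (2 * (2 * m.+1%:R)) = (2 * m.+1%:R) * pi :> R by field.
  rewrite ltr_pM2r //; have : i.+1%:R <= m%:R :> R by rewrite ler_nat.
  by rewrite -[m.+1%:R]natr1; have := ler0n R m; lra.
rewrite sin_half_inv.
- congr (4 * sin _ ^- 2); rewrite /ang nM -mulr_natl; field; exact: lt0r_neq0.
- by apply: lt0r_neq0; exact: sin_gt0_pihalf.
- apply: lt0r_neq0; apply: cos_gt0_pihalf; case/andP: hx => a b; apply/andP; split=> //; lra.
Qed.

Let T_pow k : T (2 ^ k).-1 = 2 / 3 * (4 ^+ k - 1).
Proof.
elim: k => [|k IH]; first by rewrite /T big_ord0 expr0 subrr mulr0.
have -> : (2 ^ k.+1).-1 = ((2 ^ k).-1 + (1 + (2 ^ k).-1))%N.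
  by have := expn_gt0 2 k; rewrite expnS; lia.
by rewrite T_double IH exprS; field.
Qed.

(** Along [M = 2^k] the sum [T] is [2/3 (M^2 - 1)], and [sin_bounds] compares it
    term by term with the inverse squares up to an error [M - 1]. *)
Lemma basel : (fun n => \sum_(i < n) (i.+1%:R ^- 2 : R)) @ \oo --> (pi ^+ 2 / 6 : R).
Proof.
pose Z n : R := \sum_(i < n) i.+1%:R ^- 2.
have pi0 := pi_gt0 R.
have cZ : cvgn Z.
  apply: nondecreasing_is_cvgn.
    by apply/nondecreasing_seqP => n; rewrite /Z big_ord_recr /= lerDl invr_ge0 exprn_ge0.
  by exists 2 => _ [n _ <-]; exact: sum_invsq_le.
pose sub k := (2 ^ k).-1.
have subZ : (fun k => Z (sub k)) @ \oo --> limn Z.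
  apply: (cvg_comp sub Z _ cZ); apply/cvgnyPge => A; exists A => // k /= Ak.
  rewrite /sub; have := ltn_expl k (isT : (1 < 2)%N); lia.
have bnd k : pi ^+ 2 / 6 - pi ^+ 2 * 2^-1 ^+ k <= Z (sub k) <= pi ^+ 2 / 6.
  pose M : R := 2 ^+ k; have M1 : 1 <= M by rewrite exprn_ege1 // ler1n.
  have subM : (sub k).+1%:R = M by rewrite /sub prednK ?expn_gt0 // natrX.
  have Zx : Z (sub k) * (2 * M / pi) ^+ 2 = \sum_(i < sub k) ang (sub k) i ^- 2.
    rewrite mulr_suml; apply: eq_bigr => i _; rewrite /ang subM.
    have : i.+1%:R != 0 :> R by rewrite pnatr_eq0.
    have : pi != 0 :> R by rewrite gt_eqF.
    have : M != 0 by rewrite gt_eqF //; lra.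
    move: (i.+1%:R : R) (M) (pi : R) => a b c b0 c0 a0.
    by field; rewrite a0 b0 c0.
  have inI (i : 'I_(sub k)) : 0 < ang (sub k) i < pi / 2.
    rewrite /ang subM; apply/andP; split; first by rewrite divr_gt0 ?mulr_gt0 ?ltr0n //; lra.
    rewrite ltr_pdivrMr; last by lra.
    have : i.+1%:R < M by rewrite -subM ltr_nat ltnS.
    by move=> h; rewrite mulrA divfK // mulrC ltr_pM2l.
  have up : Z (sub k) * (2 * M / pi) ^+ 2 <= 2 / 3 * (M ^+ 2 - 1).
    rewrite Zx (_ : M ^+ 2 = 4 ^+ k); last by rewrite /M -exprM mulnC exprM -natrX.
    rewrite -T_pow; apply: ler_sum => i _.
    by have /andP[] := sin_bounds _ (inI i).
  have lo : 2 / 3 * (M ^+ 2 - 1) - (M - 1) <= Z (sub k) * (2 * M / pi) ^+ 2.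
    rewrite Zx (_ : M ^+ 2 = 4 ^+ k); last by rewrite /M -exprM mulnC exprM -natrX.
    rewrite -T_pow -/(sub k).
    have -> : M - 1 = \sum_(i < sub k) 1.
      by rewrite sumr_const card_ord -subM -natr1 addrK.
    rewrite -sumrB; apply: ler_sum => i _.
    by have /andP[] := sin_bounds _ (inI i).
  have -> : (2^-1 : R) ^+ k = M^-1 by rewrite /M exprVn.
  have c0 : 0 < (2 * M / pi) ^+ 2 by rewrite exprn_gt0 // divr_gt0 //; lra.
  have piM : pi != 0 :> R by rewrite gt_eqF.
  have MM : M != 0 by rewrite gt_eqF //; lra.
  rewrite -(ler_pM2r c0) -[X in _ && X](ler_pM2r c0).
  have -> : (pi ^+ 2 / 6 - pi ^+ 2 * M^-1) * (2 * M / pi) ^+ 2 = 2 / 3 * M ^+ 2 - 4 * M.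
    by move: (pi : R) (M) piM MM => p m p0 m0; field; rewrite p0 m0.
  have -> : pi ^+ 2 / 6 * (2 * M / pi) ^+ 2 = 2 / 3 * M ^+ 2 by move: (pi : R) piM => p p0; field.
  by apply/andP; split; lra.
have lim6 : (fun k => Z (sub k)) @ \oo --> (pi ^+ 2 / 6 : R).
  apply: (@squeeze_cvgr _ _ _ _ (fun k => pi ^+ 2 / 6 - pi ^+ 2 * 2^-1 ^+ k) (fun=> pi ^+ 2 / 6)).
  - by apply: nearW.
  - rewrite -[X in _ --> X]subr0; apply: cvgB; first exact: cvg_cst.
    rewrite -[X in _ --> X](mulr0 (pi ^+ 2)); apply: cvgM; first exact: cvg_cst.
    by apply: cvg_expr; rewrite ger0_norm ?invr_ge0 // invf_lt1 // ltr1n.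
  - exact: cvg_cst.
have <- : limn Z = pi ^+ 2 / 6 by exact: (cvg_unique _ subZ lim6).
exact: cZ.
Qed.

End Basel.

(** * The first three coefficients *)

Section LowCoefficients.
Context {R : realType}.

(** Degree 2 is Newton's identity for [1, 1/2, ..., 1/j], where the factor
    [exp (lam x)] only shifts the first power sum. *)
Lemma prod_exp_coef_low j (lam : R) : let h := \sum_(i < j) i.+1%:R^-1 in [/\ prod_exp_coef j lam 0 = 1,
  prod_exp_coef j lam 1 = lam + h &
  prod_exp_coef j lam 2 = 2^-1 * ((lam + h) ^+ 2 - \sum_(i < j) i.+1%:R ^- 2)].
Proof.
move=> h; rewrite {}/h; elim: j => [|j [IH0 IH1 IH2]] /=.
  by rewrite !big_ord0 /exp_term !factS fact0 expr0 expr1; split; field.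
rewrite !big_ord_recr /= /mul_linear IH0 IH1 IH2; split; first by rewrite addr0.
  by rewrite mulr1 addrA.
by rewrite -exprVn; field; rewrite addrC natr1 pnatr_eq0.
Qed.

Lemma rgamma_coef0 : rgamma_coef R 0 = 1.
Proof.
have [_ h] := @rgamma_coef_cvg R 0; apply: (cvg_unique _ h) => //.
apply: cvg_near_cst; apply: nearW => N; rewrite /gauss_coef.
by have [] := prod_exp_coef_low N.+1 (ln N.+2%:R^-1 : R).
Qed.

Lemma rgamma_coef1 : rgamma_coef R 1 = euler_mascheroni R.
Proof.
have [_ h] := @rgamma_coef_cvg R 1; apply/esym/cvg_lim => //.
have K : (fun n => gauss_coef n 1 + n.+2%:R^-1) @ \oo --> rgamma_coef R 1.
  rewrite -[X in _ --> X]addr0; apply: cvgD; first exact: h.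
  by rewrite (cvg_shiftS (@harmonic R)); exact: cvg_harmonic.
(* the logarithm in [gauss_coef n] is that of [n + 2] *)
rewrite -(cvg_shiftn 2).
have E n : \sum_(1 <= j < (n + 2).+1) j%:R^-1 - ln (n + 2)%:R = gauss_coef n 1 + n.+2%:R^-1 :> R.
  rewrite /gauss_coef; have [_ -> _] := prod_exp_coef_low n.+1 (ln n.+2%:R^-1 : R).
  rewrite addn2 lnV ?posrE ?ltr0n // big_add1 /= big_mkord big_ord_recr /=.
  by ring.
under eq_cvg => n do rewrite /= E.
exact: K.
Qed.

Lemma rgamma_coef2 :
  rgamma_coef R 2 = 12^-1 * (6 * euler_mascheroni R ^+ 2 - pi ^+ 2).
Proof.
have [_ h2] := @rgamma_coef_cvg R 2; have [_ h1] := @rgamma_coef_cvg R 1.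
have E n : gauss_coef n 2 =
    2^-1 * (gauss_coef n 1 * gauss_coef n 1 - \sum_(i < n.+1) i.+1%:R ^- 2) :> R.
  by rewrite /gauss_coef; have [_ -> ->] := prod_exp_coef_low n.+1 (ln n.+2%:R^-1 : R).
have h2' : gauss_coef ^~ 2 @ \oo -->
    2^-1 * (rgamma_coef R 1 * rgamma_coef R 1 - pi ^+ 2 / 6).
  under eq_cvg do rewrite E.
  apply: cvgM; first exact: cvg_cst.
  apply: cvgB; first by apply: cvgM; exact: h1.
  by rewrite (cvg_shiftS (fun n => \sum_(i < n) (i.+1%:R ^- 2 : R))); exact: basel.
by rewrite (cvg_unique _ h2 h2') // -rgamma_coef1; field.
Qed.

End LowCoefficients.

(** * Integrals on the positive half-line *)

Section ImproperIntegrals.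
Context {R : realType}.
Local Notation mu := (@lebesgue_measure R).

Lemma Rintegral_dominated_cvg (D : set R) (f_ : nat -> R -> R) (f g : R -> R) :
  measurable D -> (forall n, measurable_fun D (f_ n)) -> measurable_fun D f ->
  mu.-integrable D (EFin \o g) ->
  (forall n t, D t -> `|f_ n t| <= g t) ->
  (forall t, D t -> f_ ^~ t @ \oo --> f t) ->
  mu.-integrable D (EFin \o f) /\
  (fun n => \int[mu]_(t in D) f_ n t) @ \oo --> \int[mu]_(t in D) f t.
Proof.
move=> mD mf_ mf ig fg cf.
have [i _ c] : [/\ mu.-integrable D (EFin \o f),
  (fun n => \int[mu]_(x in D) (`|(f_ n x)%:E - (f x)%:E|)%E)%E @ \oo --> 0%E &
  (fun n => \int[mu]_(x in D) ((f_ n x)%:E))%E @ \oo --> (\int[mu]_(x in D) (f x)%:E)%E].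
  apply: (@dominated_convergence _ _ _ mu D mD (fun n => EFin \o f_ n) (EFin \o f) (EFin \o g)) => //.
  - by move=> n; apply/measurable_EFinP; exact: mf_.
  - by apply/measurable_EFinP; exact: mf.
  - by apply: aeW => x Dx; apply: cvg_EFin; [exact: nearW|exact: cf].
  - by apply: aeW => x n Dx; rewrite /= lee_fin; exact: fg.
split=> //; apply: fine_cvg; rewrite fineK //.
exact: integrable_fin_num.
Qed.

Lemma integral_FTC_gt0 (f F : R -> R) (e L : R) : 0 < e < L ->
  (forall t, 0 < t -> {for t, continuous f}) ->
  (forall t : R, 0 < t -> is_derive t 1 F (f t)) ->
  (\int[mu]_(t in `[e, L]) (f t)%:E = (F L - F e)%:E)%E.
Proof.
move=> /andP[e0 eL] cf dF.
have cF t : 0 < t -> {for t, continuous F}.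
  by move=> t0; apply/differentiable_continuous/derivable1_diffP; case: (dF t t0).
rewrite (@continuous_FTC2 R f F) //.
- by apply: continuous_in_subspaceT => t; rewrite inE /= in_itv /= => /andP[et _]; apply: cf; exact: lt_le_trans et.
- split.
  + by move=> t; rewrite in_itv /= => /andP[et _]; case: (dF t (lt_trans e0 et)).
  + by apply: cvg_at_right_filter; exact: cF.
  + by apply: cvg_at_left_filter; apply: cF; exact: lt_trans eL.
- move=> t; rewrite in_itv /= => /andP[et _]; rewrite derive1E.
  by case: (dF t (lt_trans e0 et)).
Qed.

Lemma continuous_powR_gt0 (a t : R) : 0 < t -> {for t, continuous (@powR R ^~ a)}.
Proof.
move=> t0; apply/differentiable_continuous/derivable1_diffP.
by case: (is_derive1_powR a t0).
Qed.

(* cut-offs tending to 0, all smaller than [L] *)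
Let eps (L : R) n : R := L / n.+2%:R.

Let eps_itv L n : 0 < L -> 0 < eps L n < L.
Proof.
move=> L0; rewrite /eps divr_gt0 //= ltr_pdivrMr ?ltr0n // ltr_pMr // ltr1n //.
Qed.

Let eps_cvg L : eps L @ \oo --> 0.
Proof.
rewrite -(mulr0 L); apply: cvgM; first exact: cvg_cst.
by rewrite (cvg_shiftS (@harmonic R)); exact: cvg_harmonic.
Qed.

Let eps_itvcP L t : 0 < t <= L -> \forall n \near \oo, t \in `[eps L n, L].
Proof.
move=> /andP[t0 tL]; have /cvgrPdist_lt/(_ _ t0)[M _ HM] := eps_cvg L.
exists M => // n /HM /=; rewrite sub0r normrN in_itv /= tL andbT => h.
exact/ltW/(le_lt_trans (ler_norm _) h).
Qed.

(** Monotone convergence along the cut-offs: the integrals over [[eps, L]] are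
    explicit and bounded by [L^a / a]. *)
Lemma integrable_powR (a L : R) : 0 < a -> 0 < L ->
  mu.-integrable `]0, L] (EFin \o (fun t : R => t `^ (a - 1))).
Proof.
move=> a0 L0; pose f (t : R) : R := t `^ (a - 1).
rewrite -[X in EFin \o X]/f.
have mf : measurable_fun setT f by exact: measurable_powR.
have mfD D : measurable_fun D (EFin \o f) by apply/measurable_EFinP; exact: measurable_funTS.
have f0 t : 0 <= f t by exact: powR_ge0.
pose A n := `[eps L n, L]%classic : set R.
pose g n := (EFin \o f) \_ (A n).
have AD n : `]0, L] `&` A n = A n.
  rewrite setIC; apply/setIidPl => t; rewrite /A /= !in_itv /= => /andP[et ->].
  by have /andP[e0 _] := eps_itv L n L0; rewrite (lt_le_trans e0 et).
have iA n : (\int[mu]_(t in `]0%R, L]) g n t = ((L `^ a - eps L n `^ a) / a)%:E)%E.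
  rewrite -integral_mkcondr AD mulrBl.
  have := @integral_FTC_gt0 f (fun t => a^-1 * t `^ a) (eps L n) L (eps_itv L n L0).
  rewrite ![_ * a^-1]mulrC; apply.
    by move=> t t0; exact: continuous_powR_gt0.
  move=> t t0; have := is_deriveZ a^-1 (is_derive1_powR a t0).
  by move=> h; apply: is_derive_eq h _; rewrite /GRing.scale /= mulKf // gt_eqF.
apply/integrableP; split; first exact: mfD.
under eq_integral do rewrite /= ger0_norm ?f0 //.
apply: le_lt_trans (ltry (L `^ a / a)).
have nd t : `]0, L]%classic t -> {homo g ^~ t : n m / (n <= m)%N >-> (n <= m)%E}.
  move=> _ n m nm; rewrite /g !patchE; case: ifPn => [tn|_].
    rewrite ifT // inE /A /= in_itv /=; move: tn; rewrite inE /A /= in_itv /=.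
    move=> /andP[h1 ->]; rewrite andbT; apply: le_trans h1.
    by rewrite /eps ler_pM2l // lef_pV2 ?posrE ?ltr0n // ler_nat.
  by case: ifPn => // _; rewrite lee_fin.
have -> : (\int[mu]_(t in `]0%R, L]) (f t)%:E = \int[mu]_(t in `]0%R, L]) limn (g ^~ t))%E.
  apply: eq_integral => t; rewrite inE /= in_itv /= => tI; apply/esym/cvg_lim => //.
  apply: cvg_near_cst; apply: filterS (eps_itvcP _ _ tI) => n tn.
  by rewrite /g patchE ifT // inE.
have c : (fun n => \int[mu]_(t in `]0%R, L]) g n t)%E @ \oo -->
    (\int[mu]_(t in `]0%R, L]) limn (g ^~ t))%E.
  apply: (@cvg_monotone_convergence _ _ _ mu `]0, L]%classic _ g) => //.
  - move=> n; apply/measurable_restrict; [exact: measurable_itv|exact: measurable_itv|exact: mfD].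
  - by move=> n t _; rewrite /g patchE; case: ifPn => // _; rewrite lee_fin.
rewrite -(cvg_lim _ c) //; apply: lime_le; first by apply/cvg_ex; eexists; exact: c.
apply: nearW => n; rewrite iA lee_fin ler_wpM2r ?invr_ge0 ?(ltW a0) //.
by rewrite gerBl powR_ge0.
Qed.

Lemma measurable_lnM (b : R) (phi : R -> R) : continuous phi ->
  measurable_fun setT (fun t => phi (b * ln t)).
Proof.
move=> cphi; apply: (@measurableT_comp _ _ _ _ _ _ phi); first exact: continuous_measurable_fun.
by apply: measurable_funM => //; exact: measurable_ln.
Qed.

Lemma cvg_Rintegral_left (f : R -> R) (L : R) : 0 < L -> measurable_fun setT f ->
  mu.-integrable `]0, L] (EFin \o f) ->
  (fun n => \int[mu]_(t in `[eps L n, L]) f t) @ \oo --> \int[mu]_(t in `]0, L]) f t.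
Proof.
move=> L0 mf fi; pose A n := `[eps L n, L]%classic : set R.
have AD n : `]0, L] `&` A n = A n.
  rewrite setIC; apply/setIidPl => t; rewrite /A /= !in_itv /= => /andP[et ->].
  by have /andP[e0 _] := eps_itv L n L0; rewrite (lt_le_trans e0 et).
have E n : \int[mu]_(t in `[eps L n, L]) f t = \int[mu]_(t in `]0, L]) (f \_ (A n)) t.
  by rewrite -Rintegral_mkcondr AD.
under eq_cvg do rewrite E.
have [] := @Rintegral_dominated_cvg `]0, L]%classic (fun n => f \_ (A n)) f (fun t => `|f t|) => //.
- move=> n; apply/measurable_restrict; [exact: measurable_itv|exact: measurable_itv|exact: measurable_funTS].
- exact: measurable_funTS.
- exact: (integrable_norm fi).
- by move=> n t _; rewrite patchE; case: ifPn => // _; rewrite normr0.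
- move=> t tI; rewrite /= in_itv /= in tI; apply: cvg_near_cst.
  by apply: filterS (eps_itvcP _ _ tI) => n tn; rewrite patchE ifT // inE.
Qed.

Lemma cvg_powR0 (a L : R) : 0 < a -> 0 < L ->
  (fun n => eps L n `^ a) @ \oo --> 0.
Proof.
move=> a0 L0; apply/cvgrPdist_lt => e e0.
have e1 : 0 < e `^ a^-1 by exact: powR_gt0.
have /cvgrPdist_lt/(_ _ e1)[M _ HM] := eps_cvg L.
exists M => // n /HM /=; rewrite !sub0r !normrN.
have /andP[en _] := eps_itv L n L0.
rewrite !ger0_norm ?powR_ge0 ?(ltW en) // => h.
have -> : e = (e `^ a^-1) `^ a by rewrite -powRrM mulVf ?powRr1 ?(ltW e0) // gt_eqF.
by apply: gt0_ltr_powR => //; rewrite nnegrE ltW.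
Qed.

Lemma is_derive_cos_lnM (b t : R) : 0 < t ->
  is_derive t 1 (fun t : R => cos (b * ln t)) (- sin (b * ln t) * (b * t^-1)).
Proof.
move=> t0; have d1 := is_deriveZ b (is_derive1_ln t0).
exact: (@is_derive1_comp _ cos (b \*: @ln R) t).
Qed.

Lemma is_derive_sin_lnM (b t : R) : 0 < t ->
  is_derive t 1 (fun t : R => sin (b * ln t)) (cos (b * ln t) * (b * t^-1)).
Proof.
move=> t0; have d1 := is_deriveZ b (is_derive1_ln t0).
exact: (@is_derive1_comp _ sin (b \*: @ln R) t).
Qed.

Lemma derive_continuous (f : R -> R) (t df : R) : is_derive t 1 f df -> {for t, continuous f}.
Proof. by move=> [h _]; apply/differentiable_continuous/derivable1_diffP. Qed.

(** The real and imaginary parts of [t^z / z] are antiderivatives of those of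
    [t^(z-1)], where [z = a + i b]; the cosine part is [u = -1] and the sine
    part [u = 1]. *)
Lemma integral_powR_trig (a b L u : R) (phi psi : R -> R) : 0 < a -> 0 < L ->
  (forall t, `|phi t| <= 1) -> (forall t, `|psi t| <= 1) ->
  continuous phi -> 
  (forall t : R, 0 < t -> is_derive t 1 (fun t : R => phi (b * ln t)) (u * psi (b * ln t) * (b * t^-1))) ->
  (forall t : R, 0 < t -> is_derive t 1 (fun t : R => psi (b * ln t)) (- u * phi (b * ln t) * (b * t^-1))) ->
  u ^+ 2 = 1 -> 
  \int[mu]_(t in `]0, L]) (t `^ (a - 1) * phi (b * ln t)) =
  L `^ a * (a * phi (b * ln L) - u * b * psi (b * ln L)) / (a ^+ 2 + b ^+ 2).
Proof.
move=> a0 L0 phi1 psi1 cphi dphi dpsi u2.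
pose c := a ^+ 2 + b ^+ 2.
have c0 : c != 0 by rewrite gt_eqF // ltr_pwDl ?exprn_gt0 // sqr_ge0.
pose f (t : R) := t `^ (a - 1) * phi (b * ln t).
pose F (t : R) := t `^ a * (c^-1 * (a * phi (b * ln t) - u * b * psi (b * ln t))).
have mf : measurable_fun setT f.
  by apply: measurable_funM; [exact: measurable_powR|exact: measurable_lnM].
have fi : mu.-integrable `]0, L] (EFin \o f).
  apply: le_integrable (integrable_powR a L a0 L0) => //.
    by apply/measurable_EFinP; exact: measurable_funTS.
  move=> t _; rewrite /= lee_fin /f normrM ler_piMr //.
have dF (t : R) : 0 < t -> is_derive t 1 F (f t).
  move=> t0; have d1 := is_derive1_powR a t0.
  have d2 := is_deriveZ c^-1 (is_deriveB (is_deriveZ a (dphi t t0)) (is_deriveZ (u * b) (dpsi t t0))).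
  have d3 := is_deriveM d1 d2.
  pose X := b * ln t; apply: is_derive_eq d3 _.
  change (t `^ a * (c^-1 * (a * (u * psi X * (b * t^-1)) - u * b * (- u * phi X * (b * t^-1))))
    + c^-1 * (a * phi X - u * b * psi X) * (a * t `^ (a - 1)) = t `^ (a - 1) * phi X).
  rewrite -(mulr_powRB1 (ltW t0) a0).
  have t1 : t != 0 by rewrite gt_eqF.
  move: (t `^ (a - 1)) (phi _) (psi _) => p x y.
  transitivity (p * (a ^+ 2 + u ^+ 2 * b ^+ 2) / c * x); first by field; rewrite t1 c0.
  by rewrite u2 mul1r -/c mulfK.
have cf (t : R) : 0 < t -> {for t, continuous f}.
  move=> t0; have d1 := is_derive1_powR (a - 1) t0.
  exact: derive_continuous (is_deriveM d1 (dphi t t0)).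
have E n : \int[mu]_(t in `[eps L n, L]) f t = F L - F (eps L n).
  by rewrite /Rintegral (integral_FTC_gt0 f F _ _ (eps_itv L n L0) cf dF).
have l1 := cvg_Rintegral_left f L L0 mf fi.
have l3 : (fun n => F L - F (eps L n)) @ \oo --> F L - 0.
  apply: cvgB; first exact: cvg_cst.
  pose K := `|c^-1| * (`|a| + `|u * b|).
  apply/norm_cvg0P; apply: (@squeeze_cvgr _ _ _ _ (fun=> 0) (fun n => eps L n `^ a * K)).
  - apply: nearW => n; rewrite normr_ge0 /= /F normrM ger0_norm ?powR_ge0 //.
    rewrite ler_wpM2l ?powR_ge0 // normrM ler_wpM2l // (le_trans (ler_normB _ _)) //.
    by apply: lerD; rewrite normrM ler_piMr.
  - exact: cvg_cst.
  - rewrite -(mul0r K); apply: cvgM; last exact: cvg_cst.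
    exact: cvg_powR0.
have l2 : (fun n => \int[mu]_(t in `[eps L n, L]) f t) @ \oo --> F L.
  by rewrite subr0 in l3; under eq_cvg do rewrite E.
by rewrite (cvg_unique _ l1 l2) // /F mulrA [RHS]mulrAC.
Qed.

End ImproperIntegrals.

(** * Mellin transforms and Euler's beta integral *)

Section Mellin.
Context {R : realType}.
Local Notation mu := (@lebesgue_measure R).
Local Notation C := R[i].
Local Notation Re := complex.Re.
Local Notation Im := complex.Im.

(** The integral of [t^(z-1) f(t)] over [D], split into real and imaginary
    parts. *)
Definition mellin (D : set R) (f : R -> R) (z : C) : C :=
  (\int[mu]_(t in D) (t `^ (Re z - 1) * f t * cos (Im z * ln t))) +i*
  (\int[mu]_(t in D) (t `^ (Re z - 1) * f t * sin (Im z * ln t))).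

Lemma Gamma_integralE z : Gamma_integral z = mellin `]0, +oo[ (fun t => expR (- t)) z.
Proof. by []. Qed.

Lemma measurable_mellin (f phi : R -> R) a b : measurable_fun setT f -> continuous phi ->
  measurable_fun setT (fun t => t `^ a * f t * phi (b * ln t)).
Proof.
move=> mf cphi; apply: measurable_funM; last exact: measurable_lnM.
by apply: measurable_funM => //; exact: measurable_powR.
Qed.

Lemma integrable_mellin (D : set R) (f g phi : R -> R) a b :
  measurable D -> measurable_fun setT f -> continuous phi -> (forall t, `|phi t| <= 1) ->
  (forall t, D t -> `|f t| <= g t) -> mu.-integrable D (EFin \o (fun t => t `^ a * g t)) ->
  mu.-integrable D (EFin \o (fun t => t `^ a * f t * phi (b * ln t))).
Proof.
move=> mD mf cphi phi1 fg gi; apply: le_integrable gi => //.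
  by apply/measurable_EFinP; apply: measurable_funTS; exact: measurable_mellin.
move=> t Dt; rewrite /= lee_fin !normrM ger0_norm ?powR_ge0 //.
apply: le_trans (_ : t `^ a * `|f t| * 1 <= _).
  by rewrite ler_wpM2l ?mulr_ge0 ?powR_ge0.
rewrite mulr1 ler_wpM2l ?powR_ge0 //.
exact: le_trans (fg t Dt) (ler_norm _).
Qed.

Lemma cexp_powR (L : R) (z : C) : 0 < L ->
  cexp ((ln L)%:C * z) = L `^ Re z * cos (Im z * ln L) +i* (L `^ Re z * sin (Im z * ln L)).
Proof.
move=> L0; rewrite /cexp Re_scale Im_scale [ln L * Im z]mulrC /powR gt_eqF //.
by rewrite [ln L * Re z]mulrC.
Qed.

Lemma Re_gt0_neq0 (z : C) : 0 < Re z -> z != 0.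
Proof. by apply: contraTneq => ->; rewrite /= ltxx. Qed.

Lemma mellin_powR (L : R) (z : C) : 0 < L -> 0 < Re z ->
  mellin `]0, L] (fun=> 1) z = cexp ((ln L)%:C * z) / z.
Proof.
case: z => a b L0 /= a0; rewrite cexp_powR // /mellin /=.
under eq_Rintegral do rewrite mulr1.
under [X in _ +i* X]eq_Rintegral do rewrite mulr1.
have c1 (t : R) : 0 < t -> is_derive t 1 (fun t : R => cos (b * ln t)) (-1 * sin (b * ln t) * (b * t^-1)).
  by move=> t0; rewrite mulN1r; exact: is_derive_cos_lnM.
have c2 (t : R) : 0 < t -> is_derive t 1 (fun t : R => sin (b * ln t)) (- (-1) * cos (b * ln t) * (b * t^-1)).
  by move=> t0; rewrite opprK mul1r; exact: is_derive_sin_lnM.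
have s1 (t : R) : 0 < t -> is_derive t 1 (fun t : R => sin (b * ln t)) (1 * cos (b * ln t) * (b * t^-1)).
  by move=> t0; rewrite mul1r; exact: is_derive_sin_lnM.
have s2 (t : R) : 0 < t -> is_derive t 1 (fun t : R => cos (b * ln t)) (- 1 * sin (b * ln t) * (b * t^-1)).
  by move=> t0; rewrite mulN1r; exact: is_derive_cos_lnM.
have u1 : (-1 : R) ^+ 2 = 1 by rewrite sqrrN expr1n.
have u2 : (1 : R) ^+ 2 = 1 by rewrite expr1n.
rewrite (integral_powR_trig a b L (-1) cos sin a0 L0 (@cos_max R) (@sin_max R) (@continuous_cos R) c1 c2 u1).
rewrite (integral_powR_trig a b L 1 sin cos a0 L0 (@sin_max R) (@cos_max R) (@continuous_sin R) s1 s2 u2).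
have c0 : a ^+ 2 + b ^+ 2 != 0 by rewrite gt_eqF // ltr_pwDl ?exprn_gt0 // sqr_ge0.
by apply/eqP; rewrite eq_complex /=; apply/andP; split; apply/eqP; field.
Qed.

Definition beta_weight (L : R) (m : nat) (t : R) : R := (1 - t / L) ^+ m.

Lemma measurable_beta_weight L m : measurable_fun setT (beta_weight L m).
Proof.
apply: measurable_funX; apply: measurable_funB => //.
by apply: measurable_funM.
Qed.

Lemma beta_weight_le1 (L : R) m t : 0 < L -> `]0, L]%classic t -> `|beta_weight L m t| <= 1.
Proof.
move=> L0; rewrite /= in_itv /= => /andP[t0 tL]; rewrite /beta_weight normrX.
have h1 : 0 <= t / L by rewrite divr_ge0 // ltW.
have h2 : t / L <= 1 by rewrite ler_pdivrMr // mul1r.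
by rewrite exprn_ile1 // ger0_norm; lra.
Qed.

Lemma mellin_beta_weight_step (L : R) (m : nat) (z : C) : 0 < L -> 0 < Re z ->
  mellin `]0, L] (beta_weight L m.+1) z =
  mellin `]0, L] (beta_weight L m) z - (L^-1)%:C * mellin `]0, L] (beta_weight L m) (z + 1).
Proof.
case: z => a b L0 /= a0.
have key (phi : R -> R) : continuous phi -> (forall t, `|phi t| <= 1) ->
  \int[mu]_(t in `]0, L]) (t `^ (a - 1) * beta_weight L m.+1 t * phi (b * ln t)) =
  \int[mu]_(t in `]0, L]) (t `^ (a - 1) * beta_weight L m t * phi (b * ln t)) -
  L^-1 * \int[mu]_(t in `]0, L]) (t `^ (a + 1 - 1) * beta_weight L m t * phi (b * ln t)).
  move=> cphi phi1.
  have int (c : R) : 0 < c -> mu.-integrable `]0, L]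
      (EFin \o (fun t => t `^ (c - 1) * beta_weight L m t * phi (b * ln t))).
    move=> c0; apply: (integrable_mellin _ _ (fun=> 1)) => //; first exact: measurable_beta_weight.
      by move=> t; exact: beta_weight_le1.
    have -> : (fun t : R => t `^ (c - 1) * 1) = (fun t => t `^ (c - 1)).
      by apply/funext => t; rewrite mulr1.
    exact: integrable_powR.
  have a1 : 0 < a + 1 by rewrite addr_gt0.
  rewrite -RintegralZl //; last exact: int.
  rewrite -RintegralB //; [|exact: int|]; last first.
    have h := @integrableZl _ _ _ mu `]0, L]%classic (measurable_itv _) L^-1 _ (int _ a1).
    by apply: eq_integrable h => // t _; rewrite /= EFinM.
  apply: eq_Rintegral => t; rewrite inE /= in_itv /= => /andP[t0 _].
  rewrite addrK -(mulr_powRB1 (ltW t0) a0) /beta_weight exprS.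
  by field; rewrite gt_eqF.
rewrite /mellin /= addr0 (key cos); [|exact: continuous_cos|exact: (@cos_max R)].
rewrite (key sin); [|exact: continuous_sin|exact: (@sin_max R)].
by apply/eqP; rewrite eq_complex /=; simpc; rewrite ?eqxx.
Qed.

Lemma cexp_mulD1 (L : R) (z : C) : 0 < L ->
  cexp ((ln L)%:C * (z + 1)) = L%:C * cexp ((ln L)%:C * z).
Proof.
case: z => a b L0; rewrite !cexp_powR //= addr0.
rewrite powRD ?(gt_eqF L0) ?implybT // powRr1 ?(ltW L0) //.
by apply/eqP; rewrite eq_complex /=; apply/andP; split; apply/eqP; ring.
Qed.

(** Euler's beta integral. Writing one factor [1 - t/L] as a difference yields a
    recurrence between [z] and [z + 1], and the quotients of products on the
    right satisfy the same one, so no integration by parts is needed. *)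
Lemma mellin_beta_weight (L : R) (m : nat) (z : C) : 0 < L -> 0 < Re z ->
  mellin `]0, L] (beta_weight L m) z =
  cexp ((ln L)%:C * z) * m`!%:R / \prod_(i < m.+1) (z + i%:R).
Proof.
move=> L0; elim: m z => [|m IH] z z0.
  by rewrite big_ord1 addr0 fact0 mulr1 -mellin_powR.
have z1 : 0 < Re (z + 1) by rewrite ReD /= addr_gt0.
rewrite (mellin_beta_weight_step L m z L0 z0) (IH z) // (IH (z + 1)) // cexp_mulD1 //.
have LC : L%:C != 0 :> C by rewrite (_ : 0 = 0%:C) // (inj_eq (@complexI R)) gt_eqF.
rewrite fmorphV !mulrA mulVf // mul1r.
have nz i : z + i%:R != 0.
  apply: Re_gt0_neq0; have -> : (i%:R : C) = (i%:R : R)%:C by rewrite rmorph_nat.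
  by rewrite ReD /= ltr_wpDr.
pose P := \prod_(i < m) (z + i.+1%:R).
have P0 : P != 0 by apply/prodf_neq0 => i _; exact: nz.
have e1 : \prod_(i < m.+1) (z + i%:R) = z * P.
  by rewrite big_ord_recl /= addr0; congr (_ * _); apply: eq_bigr => i _.
have e2 : \prod_(i < m.+1) (z + 1 + i%:R) = P * (z + m.+1%:R).
  rewrite big_ord_recr /= -addrA nat1r; congr (_ * _); apply: eq_bigr => i _.
  by rewrite -addrA nat1r.
have e3 : \prod_(i < m.+2) (z + i%:R) = z * P * (z + m.+1%:R).
  by rewrite big_ord_recr /= e1.
rewrite e1 e2 e3 factS natrM.
have z00 : z != 0 by rewrite -[z]addr0 (nz 0).
have := nz m.+1; move: (cexp _) (m`!%:R) (m.+1%:R) (P) P0 => E f k Q Q0 zk.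
by field; rewrite z00 Q0 zk.
Qed.

End Mellin.

(** * The Gauss product converges to the reciprocal gamma function *)

Section GammaLimit.
Context {R : realType}.
Local Notation mu := (@lebesgue_measure R).
Local Notation C := R[i].
Local Notation Re := complex.Re.
Local Notation Im := complex.Im.

Lemma integrable_expR_half :
  mu.-integrable `]0, +oo[ (EFin \o (fun t : R => expR (- (2^-1 * t)))).
Proof.
pose f (t : R) : R := expR (- (2^-1 * t)); pose F (t : R) : R := - 2 * f t.
have df (t : R) : is_derive t 1 f (- 2^-1 * f t).
  have h : is_derive t 1 (fun t : R => - (2^-1 * t)) (- 2^-1).
    apply: (is_derive_eq (is_deriveN (is_deriveZ (2^-1) (is_derive_id t 1)))).
    by rewrite /GRing.scale /= mulr1.
  apply: (is_derive_eq (@is_derive1_comp _ expR _ t _ _ (is_derive_expR _) h)).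
  by rewrite mulrC.
have dF (t : R) : is_derive t 1 F (f t).
  apply: is_derive_eq (is_deriveZ (- 2) (df t)) _.
  by rewrite /GRing.scale /= mulrA mulrNN mulfV ?mul1r.
have cf : continuous f by move=> t; exact: derive_continuous (df t).
have cF : continuous F by move=> t; exact: derive_continuous (dF t).
have limF : F x @[x --> +oo] --> (0 : R).
  rewrite -(mulr0 (- 2)); apply: cvgM; first exact: cvg_cst.
  apply: (@cvg_comp _ _ _ (fun t : R => 2^-1 * t) (fun y : R => expR (- y)) _ +oo); last exact: cvgr_expR.
  by apply: gt0_cvgMry; [rewrite invr_gt0|exact: cvg_id].
have I : (\int[mu]_(t in `[0%R, +oo[) (f t)%:E = 0%:E - (F 0)%:E)%E.
  apply: ge0_continuous_FTC2y limF _ _ _ => //.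
  - by move=> t _; exact: expR_ge0.
  - exact: continuous_subspaceT.
  - by apply: cvg_at_right_filter; exact: cF.
  - by move=> t _; rewrite derive1E; case: (dF t).
apply: (@integrableS _ _ _ mu `[0, +oo[%classic) => //.
  by move=> t; rewrite /= !in_itv /= !andbT; exact: ltW.
apply/integrableP; split.
  by apply/measurable_EFinP; apply: measurable_funTS; exact: continuous_measurable_fun.
under eq_integral do rewrite /= ger0_norm ?expR_ge0 //.
by rewrite I sub0e ltry.
Qed.

(** [t^n / n!] is a term of the exponential series; it is used at [t / 2] so that
    half of the exponential decay survives. *)
Lemma powR_expR_le (a t : R) : 1 <= t ->
  t `^ (a - 1) * expR (- t) <=
  2 ^+ (Num.truncn a).+1 * (Num.truncn a).+1`!%:R * expR (- (2^-1 * t)).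
Proof.
move=> t1; set n := Num.truncn a; have t0 : 0 < t by exact: lt_le_trans t1.
have na : a - 1 <= n.+1%:R by have := truncnS_gt a; rewrite -/n; lra.
have h1 : t `^ (a - 1) <= t ^+ n.+1.
  by rewrite -powR_mulrn ?(ltW t0) //; exact: ler_powR.
have h2 : t ^+ n.+1 <= 2 ^+ n.+1 * n.+1`!%:R * expR (2^-1 * t).
  have h0 : 0 <= 2^-1 * t by rewrite mulr_ge0 ?invr_ge0 ?(ltW t0).
  have := expR_ge1Dxn n h0.
  have -> : t ^+ n.+1 = 2 ^+ n.+1 * n.+1`!%:R * ((2^-1 * t) ^+ n.+1 / n.+1`!%:R).
    rewrite exprMn exprVn; field.
    by rewrite expf_neq0 //= pnatr_eq0 -lt0n fact_gt0.
  by move=> h; rewrite ler_wpM2l ?mulr_ge0 ?exprn_ge0 //; lra.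
have -> : - (2^-1 * t) = 2^-1 * t + - t by lra.
by rewrite expRD mulrA ler_wpM2r ?expR_ge0 // (le_trans h1).
Qed.

Lemma integrable_powR_expR (a K : R) : 0 < a -> 0 <= K ->
  mu.-integrable `]0, +oo[ (EFin \o (fun t : R => t `^ (a - 1) * (K * expR (- t)))).
Proof.
move=> a0 K0; pose M : R := 2 ^+ (Num.truncn a).+1 * (Num.truncn a).+1`!%:R.
pose f1 : R -> \bar R := (EFin \o (fun t : R => t `^ (a - 1))) \_ `]0, 1].
pose f2 : R -> \bar R := EFin \o (fun t : R => expR (- (2^-1 * t))).
have i1 : mu.-integrable `]0, +oo[ f1.
  apply/integrable_restrict => //.
  rewrite (_ : _ `&` _ = `]0, 1]%classic); first exact: integrable_powR.
  by rewrite setIC; apply/setIidPl => t; rewrite /= !in_itv /= andbT => /andP[].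
have i2 : mu.-integrable `]0, +oo[ f2 := integrable_expR_half.
have mD : measurable (`]0, +oo[%classic : set R) := measurable_itv _.
have i3 := @integrableZl _ _ _ mu _ mD K _ i1.
have i4 := @integrableZl _ _ _ mu _ mD (K * M) _ i2.
apply: le_integrable (@integrableD _ _ _ mu _ mD _ _ i3 i4) => //.
  apply/measurable_EFinP; apply: measurable_funTS; apply: measurable_funM; first exact: measurable_powR.
  apply: measurable_funM => //; apply: measurableT_comp => //.
move=> t; rewrite /= in_itv /= andbT => t0.
have M0 : 0 <= M by rewrite mulr_ge0 ?exprn_ge0.
have ->: f1 t = (if t <= 1 then t `^ (a - 1) else 0)%:E.
  rewrite /f1 patchE; case: ifPn; rewrite ?inE ?notin_setE /= in_itv /= t0 /=; first by move=> ->.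
  by move=> /negP/negbTE ->.
rewrite -!EFinM -EFinD lee_fin.
have e0 := expR_ge0 (- t); have e1 := expR_ge0 (- (2^-1 * t)); have p0 := powR_ge0 t (a - 1).
have hl : 0 <= t `^ (a - 1) * (K * expR (- t)) by rewrite !mulr_ge0.
have hr : 0 <= K * (if t <= 1 then t `^ (a - 1) else 0) + K * M * expR (- (2^-1 * t)).
  by apply: addr_ge0; [apply: mulr_ge0 => //; case: ifP|rewrite !mulr_ge0].
rewrite (ger0_norm hl) (ger0_norm hr).
case: ifPn => [t1|]; last first.
  rewrite -ltNge mulr0 add0r => /ltW t1; rewrite mulrCA -mulrA ler_wpM2l //.
  exact: powR_expR_le.
apply: le_trans (_ : K * t `^ (a - 1) <= _); last by rewrite lerDl !mulr_ge0.
rewrite mulrCA ler_wpM2l // ler_piMr // -expR0 ler_expR oppr_le0; exact: ltW.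
Qed.

Lemma bernoulli_le (v : R) n : 0 <= v <= 1 -> 1 - n%:R * v <= (1 - v) ^+ n.
Proof.
move=> /andP[v0 v1]; elim: n => [|n IH]; first by rewrite mul0r subr0 expr0.
have h : (1 - v) * (1 - n%:R * v) <= (1 - v) * (1 - v) ^+ n by rewrite ler_wpM2l // subr_ge0.
rewrite exprS -natr1; have := ler0n R n; nra.
Qed.

(** The upper bound is [1 - u <= exp (- u)]; the lower one comes from
    [exp t >= (1 + t/L)^N] and Bernoulli's inequality for [(1 - t^2/L^2)^N]. *)
Lemma beta_weight_itv (N : nat) (t : R) : 0 < t <= N.+2%:R ->
  expR (- t) * (1 - t ^+ 2 / N.+2%:R) <= beta_weight N.+2%:R N t
    <= expR (- t) * expR (2 * t / N.+2%:R).
Proof.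
move=> /andP[t0 tL]; set L : R := N.+2%:R; have L0 : 0 < L by rewrite ltr0n.
have L2 : N%:R + 2 = L by rewrite /L -natrD addn2.
set u := t / L; have u0 : 0 <= u by rewrite divr_ge0 // ltW.
have u1 : u <= 1 by rewrite ler_pdivrMr // mul1r.
have tu : t = L * u by rewrite /u mulrCA mulfV ?mulr1 // gt_eqF.
have b0 : 0 <= 1 - u by rewrite subr_ge0.
rewrite /beta_weight -/u; apply/andP; split; last first.
  rewrite -expRD; have -> : - t + 2 * t / L = N%:R * (- u).
    by rewrite -mulrA -/u tu -L2; ring.
  rewrite expRM_natl lerXn2r ?nnegrE ?expR_ge0 //.
  exact: expR_ge1Dx.
have e0 : 0 < expR t := expR_gt0 t.
rewrite expRN mulrC ler_pdivrMr //.
apply: le_trans (_ : (1 - u ^+ 2) ^+ N <= _).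
  apply: le_trans (bernoulli_le (u ^+ 2) N _); last by rewrite sqr_ge0 /= exprn_ile1.
  rewrite lerB // (_ : t ^+ 2 / L = L * u ^+ 2); last by rewrite /u; field; rewrite gt_eqF.
  by rewrite ler_wpM2r ?sqr_ge0 // -L2 lerDl.
have -> : 1 - u ^+ 2 = (1 - u) * (1 + u) by ring.
rewrite exprMn ler_wpM2l ?exprn_ge0 //.
apply: le_trans (_ : expR u ^+ N <= _).
  by rewrite lerXn2r ?nnegrE ?expR_ge0 ?addr_ge0 //; exact: expR_ge1Dx.
by rewrite -expRM_natl ler_expR [leRHS]tu ler_wpM2r // -L2 lerDl.
Qed.

Lemma cvg_div_succ2 (c : R) : (fun N => c / N.+2%:R) @ \oo --> 0.
Proof.
rewrite -(mulr0 c); apply: cvgM; first exact: cvg_cst.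
by rewrite (cvg_shiftS (@harmonic R)); exact: cvg_harmonic.
Qed.

Lemma cvg_beta_weight (t : R) : 0 < t -> (fun N => beta_weight N.+2%:R N t) @ \oo --> expR (- t).
Proof.
move=> t0; apply: (@squeeze_cvgr _ _ _ _ (fun N => expR (- t) * (1 - t ^+ 2 / N.+2%:R))
    (fun N => expR (- t) * expR (2 * t / N.+2%:R))).
- exists (Num.truncn t) => // N /= tN; apply: beta_weight_itv; rewrite t0 /=.
  by apply/ltW/(lt_le_trans (truncnS_gt t)); rewrite ler_nat ltnS leqW.
- rewrite -[X in _ --> X]mulr1; apply: cvgM; first exact: cvg_cst.
  rewrite -[X in _ --> X]subr0; apply: cvgB; [exact: cvg_cst|exact: cvg_div_succ2].
- rewrite -[X in _ --> X]mulr1; apply: cvgM; first exact: cvg_cst.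
  rewrite -[X in _ --> X]expR0; apply: continuous_cvg; first exact: continuous_expR.
  exact: cvg_div_succ2.
Qed.

(** Dominated convergence, with [exp 2 * exp (- t)] dominating the weights on
    their support. *)
Lemma mellin_beta_weight_cvg (z : C) : 0 < Re z ->
  (fun N => mellin `]0, N.+2%:R] (beta_weight N.+2%:R N) z) @ \oo --> (Gamma_integral z : C^o).
Proof.
case: z => a b /= a0; rewrite Gamma_integralE.
have key (phi : R -> R) : continuous phi -> (forall t, `|phi t| <= 1) ->
  (fun N => \int[mu]_(t in `]0, N.+2%:R]) (t `^ (a - 1) * beta_weight N.+2%:R N t * phi (b * ln t))) @ \oo -->
  \int[mu]_(t in `]0, +oo[) (t `^ (a - 1) * expR (- t) * phi (b * ln t)).
  move=> cphi phi1.
  pose f N (t : R) : R := t `^ (a - 1) * beta_weight N.+2%:R N t * phi (b * ln t).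
  pose A N : set R := `]0, N.+2%:R]%classic.
  have DA N : `]0, +oo[ `&` A N = A N.
    by rewrite setIC; apply/setIidPl => t; rewrite /A /= !in_itv /= andbT => /andP[].
  have E N : \int[mu]_(t in `]0, N.+2%:R]) f N t = \int[mu]_(t in `]0, +oo[) (f N \_ (A N)) t.
    by rewrite -Rintegral_mkcondr DA.
  under eq_cvg do rewrite E.
  have mf N : measurable_fun setT (f N) by apply: measurable_mellin => //; exact: measurable_beta_weight.
  have [] := @Rintegral_dominated_cvg R `]0, +oo[%classic (fun N => f N \_ (A N))
    (fun t => t `^ (a - 1) * expR (- t) * phi (b * ln t))
    (fun t => t `^ (a - 1) * (expR 2 * expR (- t))) => //.
  - move=> N; apply/measurable_restrict; [exact: measurable_itv|exact: measurable_itv|].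
    exact: measurable_funTS.
  - apply: measurable_funTS; apply: measurable_mellin => //.
    by apply: measurableT_comp.
  - by apply: integrable_powR_expR => //; exact: expR_ge0.
  - move=> N t Dt; rewrite patchE; case: ifPn => [|_]; last first.
      by rewrite normr0 !mulr_ge0 ?powR_ge0 ?expR_ge0.
    rewrite inE /A /= in_itv /= => tI.
    have /andP[h1 h2] := beta_weight_itv N t tI.
    have L0 : 0 < N.+2%:R :> R by rewrite ltr0n.
    have h0 : 0 <= beta_weight N.+2%:R N t.
      by rewrite exprn_ge0 // subr_ge0 ler_pdivrMr // mul1r; case/andP: tI.
    rewrite /f !normrM (ger0_norm h0) ger0_norm ?powR_ge0 //.
    rewrite -mulrA ler_wpM2l ?powR_ge0 //.
    apply: le_trans (_ : beta_weight N.+2%:R N t * 1 <= _); first by rewrite ler_wpM2l.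
    rewrite mulr1 (le_trans h2) // mulrC ler_wpM2r ?expR_ge0 // ler_expR.
    by rewrite ler_pdivrMr // ler_pM2l //; case/andP: tI.
  - move=> t; rewrite /= in_itv /= andbT => t0.
    have c : f ^~ t @ \oo --> t `^ (a - 1) * expR (- t) * phi (b * ln t).
      apply: cvgM; last exact: cvg_cst.
      by apply: cvgM; [exact: cvg_cst|exact: cvg_beta_weight].
    apply: cvg_trans c; apply: near_eq_cvg.
    exists (Num.truncn t) => // N /= tN; rewrite patchE ifT // inE /A /= in_itv /= t0 /=.
    by apply/ltW/(lt_le_trans (truncnS_gt t)); rewrite ler_nat ltnS leqW.
apply: cvgC_ReIm => /=.
  by apply: key; [exact: continuous_cos|exact: (@cos_max R)].
by apply: key; [exact: continuous_sin|exact: (@sin_max R)].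
Qed.

Lemma cexpNM (z : C) : cexp (- z) * cexp z = 1.
Proof.
case: z => a b; rewrite /cexp /= cosN sinN; apply/eqP; rewrite eq_complex /=.
have e : expR (- a) * expR a = 1 by rewrite -expRD addNr expR0.
have h := cos2Dsin2 b; apply/andP; split; apply/eqP; last by ring.
transitivity ((expR (- a) * expR a) * (cos b ^+ 2 + sin b ^+ 2)); first by ring.
by rewrite e h mulr1.
Qed.

Lemma gauss_mellin (N : nat) (x : C) : 0 < Re (x + 1) ->
  gauss_rgamma N x * mellin `]0, N.+2%:R] (beta_weight N.+2%:R N) (x + 1) = N.+2%:R / N.+1%:R.
Proof.
move=> x1; have L0 : 0 < N.+2%:R :> R by rewrite ltr0n.
rewrite (mellin_beta_weight _ _ _ L0 x1) cexp_mulD1 // /gauss_rgamma.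
rewrite lnV ?posrE // rmorphN mulNr.
set E := cexp (_ * x).
have EE : cexp (- ((ln N.+2%:R)%:C * x)) * E = 1 by rewrite cexpNM.
have -> : \prod_(i < N.+1) (1 + x / i.+1%:R) = (\prod_(i < N.+1) (x + 1 + i%:R)) / (N.+1)`!%:R.
  rewrite fact_prod natr_prod big_add1 big_mkord -prodf_div; apply: eq_bigr => i _.
  have i0 : i.+1%:R != 0 :> C by rewrite pnatr_eq0.
  by rewrite -addrA nat1r mulrDl divff // addrC.
set P := \prod_(i < N.+1) _.
have P0 : P != 0.
  apply/prodf_neq0 => i _; apply: Re_gt0_neq0.
  have -> : (i%:R : C) = (i%:R : R)%:C by rewrite rmorph_nat.
  by rewrite ReD /= ltr_wpDr.
rewrite rmorph_nat factS natrM.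
have f0 : N`!%:R != 0 :> C by rewrite pnatr_eq0 -lt0n fact_gt0.
have N0 : N.+1%:R != 0 :> C by rewrite pnatr_eq0.
move: (N.+1%:R : C) (N`!%:R : C) (N.+2%:R : C) P P0 N0 f0 EE => m f L P P0 m0 f0 EE.
transitivity (L / m * (cexp (- ((ln N.+2%:R)%:C * x)) * E)); last by rewrite EE mulr1.
by field; rewrite m0 f0 P0.
Qed.

(** The functional equation of [1 / Gamma], up to a factor tending to 1. *)
Lemma gauss_rgamma_shift (N : nat) (x : C) :
  gauss_rgamma N x * (1 + x / N.+2%:R) = (x + 1) * gauss_rgamma N (x + 1).
Proof.
have L0 : 0 < N.+2%:R :> R by rewrite ltr0n.
have LV0 : 0 < N.+2%:R^-1 :> R by rewrite invr_gt0.
rewrite /gauss_rgamma cexp_mulD1 // fmorphV rmorph_nat.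
set E := cexp _.
have pe (y : C) n : \prod_(i < n) (1 + y / i.+1%:R) = (\prod_(i < n) (y + i.+1%:R)) / n`!%:R.
  rewrite fact_prod natr_prod big_add1 big_mkord -prodf_div; apply: eq_bigr => i _.
  have i0 : i.+1%:R != 0 :> C by rewrite pnatr_eq0.
  by rewrite mulrDl divff // addrC.
rewrite !pe big_ord_recl /= [X in _ = (x + 1) * (X / _ * _)]big_ord_recr /=.
have -> : \prod_(i < N) (x + 1 + i.+1%:R) = \prod_(i < N) (x + (bump 0 i).+1%:R).
  by apply: eq_bigr => i _; rewrite /bump /= add1n -addrA nat1r.
have f0 : (N.+1)`!%:R != 0 :> C by rewrite pnatr_eq0 -lt0n fact_gt0.
have N0 : N.+2%:R != 0 :> C by rewrite pnatr_eq0.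
have -> : x + 1 + N.+1%:R = x + N.+2%:R by rewrite -addrA nat1r.
move: (\prod_(i < N) _) ((N.+1)`!%:R : C) (N.+2%:R : C) f0 N0 => P f L f0 L0'.
by field; rewrite f0 L0'.
Qed.

(** For [Re x > -1] the product of the Gauss approximation with the beta
    integral tends to 1. The functional equation carries this to the whole
    plane, along the recursion by which [Gamma] is continued; at the poles the
    vanishing factor appears on both sides. *)
Lemma gauss_rgamma_cvg (x : C) : gauss_rgamma ^~ x @ \oo --> ((Gamma (x + 1))^-1 : C^o).
Proof.
have lim (y : C) : exists l : C, gauss_rgamma ^~ y @ \oo --> (l : C^o).
  by have [l [_ h]] := rgamma_series_cvg y; exists l.
have invN (c : C) : (fun N => c / N.+2%:R) @ \oo --> (0 : C^o).
  have h : (fun N => (N.+2%:R^-1 : R)%:C) @ \oo --> (0 : C^o).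
    by apply: cvgC_real; under eq_cvg do rewrite -[_^-1]mul1r; exact: cvg_div_succ2.
  have := cvgCM _ _ _ _ (cvgC_cst c) h; rewrite mulr0.
  by apply: cvgC_eq => n; rewrite fmorphV rmorph_nat.
have base (y l : C) : 0 < Re (y + 1) -> gauss_rgamma ^~ y @ \oo --> (l : C^o) ->
    l = (Gamma_integral (y + 1))^-1.
  move=> y1 yl; have h := cvgCM _ _ _ _ yl (mellin_beta_weight_cvg _ y1).
  have h1 : (fun N => gauss_rgamma N y * mellin `]0, N.+2%:R] (beta_weight N.+2%:R N) (y + 1)) @ \oo --> (1 : C^o).
    have h0 : (fun N => 1 + (N.+1%:R^-1 : R)%:C) @ \oo --> (1 + 0 : C^o).
      by apply: cvgCD; [exact: cvgC_cst|apply: cvgC_real; exact: cvg_harmonic].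
    rewrite addr0 in h0; apply: cvgC_eq h0 => N.
    by rewrite gauss_mellin // fmorphV rmorph_nat -[N.+2%:R]natr1 mulrDl mul1r divff //.
  have e := cvgC_unique _ _ _ h h1.
  have G0 : Gamma_integral (y + 1) != 0.
    by apply/eqP => G0; move/eqP: e; rewrite G0 mulr0 eq_sym oner_eq0.
  by rewrite -[l](mulfK G0) e mul1r.
pose l y : C := projT1 (cid (lim y)).
have lP (y : C) : gauss_rgamma ^~ y @ \oo --> (l y : C^o) by rewrite /l; case: cid.
have lS (y : C) : l y = (y + 1) * l (y + 1).
  have h1 : (fun N => gauss_rgamma N y * (1 + y / N.+2%:R)) @ \oo --> (l y * (1 + 0) : C^o).
    by apply: cvgCM (lP y) _; apply: cvgCD; [exact: cvgC_cst|exact: invN].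
  have h2 : (fun N => (y + 1) * gauss_rgamma N (y + 1)) @ \oo --> ((y + 1) * l (y + 1) : C^o).
    by apply: cvgCM (lP _); exact: cvgC_cst.
  rewrite addr0 mulr1 in h1; apply: cvgC_unique h1 _; apply: cvgC_eq h2 => N.
  by rewrite gauss_rgamma_shift.
have lm (m : nat) (y : C) : l y = \prod_(j < m) (y + 1 + j%:R) * l (y + m%:R).
  elim: m => [|m IH]; first by rewrite big_ord0 mul1r addr0.
  rewrite IH lS big_ord_recr /= -mulrA; congr (_ * (_ * l _)).
    by rewrite addrAC.
  by rewrite -addrA natr1.
suff -> : (Gamma (x + 1))^-1 = l x by exact: lP.
rewrite /Gamma; set m := Num.truncn _.
have m0 : 0 < Re (x + m%:R + 1).
  have := truncnS_gt (1 - Re (x + 1)); rewrite -/m -natr1.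
  have -> : (m%:R : C) = (m%:R : R)%:C by rewrite rmorph_nat.
  by case: (x) => a b; rewrite /=; lra.
rewrite (lm m x) (base _ _ m0 (lP _)) invfM invrK mulrC.
by rewrite addrAC.
Qed.

End GammaLimit.

(** * The Maclaurin series of the reciprocal gamma function *)

Theorem theorem2p2 (R : realType) :
  [/\ forall k : nat,
        cvgn (series (fun n => ratr (rgamma_term k n) : R)),
      forall x : R[i],
        series (fun k => (rgamma_coef R k)%:C * x ^+ k) @ \oo -->
          ((Gamma (x + 1))^-1 : R[i]^o),
      rgamma_coef R 0 = 1,
      rgamma_coef R 1 = euler_mascheroni R
    & rgamma_coef R 2 = 12^-1 * (6 * euler_mascheroni R ^+ 2 - pi ^+ 2)].
Proof.
split.
- by move=> k; have [] := @rgamma_coef_cvg R k.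
- move=> x; have [l [sl gl]] := rgamma_series_cvg x.
  suff -> : (Gamma (x + 1))^-1 = l by [].
  exact: cvgC_unique _ _ _ (gauss_rgamma_cvg x) gl.
- exact: rgamma_coef0.
- exact: rgamma_coef1.
- exact: rgamma_coef2.
Qed.
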